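(* Let $0<\alpha<n$ and let $T_\alpha$ be a fractional type operator of convolution type whose kernel $K_\alpha$ satisfies the size condition $S_\alpha^*$ and the smoothness condition $H^*_{\alpha,\infty}$ with exponent $\gamma\in(0,1]$. Let $m\in\mathbb{N}\cup\{0\}$, $0<\delta<\min\{\gamma,(n-\alpha)/m\}$, $\tilde\alpha=m\delta+\alpha$, $1\le r\le\infty$ and $\tilde\delta\le\tilde\alpha-n/r$. Let $b\in\Lambda(\delta)$. If $(v,w)\in\mathbb{H}(r,\tilde\alpha,\tilde\delta)$, then there is a constant $C>0$, independent of $f$ and $b$, such that $$\|T^m_{\alpha,b}f\|_{\mathbb{L}_w(\tilde\delta/n)}\le C\,\|b\|^m_{\Lambda(\delta)}\,\|f/v\|_{L^r(\mathbb{R}^n)}$$ for every $f$ such that $f/v\in L^r(\mathbb{R}^n)$.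
   Context: Conventions: $(n-\alpha)/m=\infty$ if $m=0$; $n/r=0$ if $r=\infty$; $r'$ is the conjugate exponent of $r$; a weight is a locally integrable function on $\mathbb{R}^n$ with values in $(0,\infty)$ a.e.; $m_B(f)=\frac1{|B|}\int_B f$. Operators. $T_\alpha f(x)=\int_{\mathbb{R}^n}K_\alpha(x-y)f(y)\,dy$, with $K_\alpha$ not identically zero. $K_\alpha$ satisfies $S_\alpha^*$ if $|K_\alpha(x)|\le C|x|^{\alpha-n}$ for some $C>0$. $K_\alpha$ satisfies $H^*_{\alpha,\infty}$ if there are $C>0$ and $0<\gamma\le1$ with $$|K_\alpha(x-y)-K_\alpha(x'-y)|+|K_\alpha(y-x)-K_\alpha(y-x')|\le C\frac{|x-x'|^\gamma}{|x-y|^{n-\alpha+\gamma}}\quad\text{whenever }|x-y|\ge2|x-x'|.$$ Commutators: $T^0_{\alpha,b}=T_\alpha$, and $T^m_{\alpha,b}=[b,T^{m-1}_{\alpha,b}]$, where $[b,S]f=b\,Sf-S(bf)$. Function classes. For $0<\delta<1$, $b\in\Lambda(\delta)$ if $|b(x)-b(y)|\le C|x-y|^\delta$ for all $x,y\in\mathbb{R}^n$; the smallest such $C$ is $\|b\|_{\Lambda(\delta)}$. For $\beta\in\mathbb{R}$ and a weight $w$, $$\|f\|_{\mathbb{L}_w(\beta)}=\sup_B\frac{\|(1/w)\chi_B\|_\infty}{|B|^{1+\beta}}\int_B|f(x)-m_B(f)|\,dx,$$ the supremum being over all balls. Weights. For $\tilde\delta\le\delta$ and $1<r\le\infty$, a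 pair of weights $(v,w)$ belongs to $\mathbb{H}(r,\tilde\alpha,\tilde\delta)$ (a class that also depends on $\delta$) if $$\sup_B\|(1/w)\chi_B\|_{\infty}|B|^{\frac{\delta-\tilde\delta}{n}}\left(\int_{\mathbb{R}^n}\frac{v^{r'}(y)}{\left(|B|^{1/n}+|x_B-y|\right)^{r'(n-\tilde\alpha+\delta)}}\,dy\right)^{1/r'}<\infty,$$ the supremum being over all balls $B$, with center $x_B$. For $r=1$, the factor $(\int\cdots)^{1/r'}$ is replaced by $\left\|v(\cdot)\left(|B|^{1/n}+|x_B-\cdot|\right)^{-(n-\tilde\alpha+\delta)}\right\|_\infty$.
   Formalization: Since the integrals defining T^m f may diverge for f/v in L^r, the bound is proved literally when they converge absolutely a.e., and for every such f with T^m f read modulo constants as the limit of truncations; f, v, w are real-valued and Borel. *)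

(* Defs.v *)
From HB Require Import structures.
From mathcomp Require Import all_boot all_order all_algebra.
From mathcomp Require Import all_classical all_reals all_analysis.

Set Implicit Arguments.
Unset Strict Implicit.
Unset Printing Implicit Defensive.
Import Order.TTheory GRing.Theory Num.Theory.
Import numFieldNormedType.Exports.

Local Open Scope classical_set_scope.
Local Open Scope ring_scope.

(* The analysis library has no Lebesgue measure on R^n, so it is built here.
   R^n is 'rV[R]_n with the sigma-algebra generated by the coordinates. *)
Section rV_measurable.
Context (R : realType) (n : nat).

Let coord (i : 'I_n) (x : 'rV[R]_n) : R := x ord0 i.

Let rV_set0 : g_sigma_preimage coord set0.
Proof. exact: sigma_algebra0. Qed.

Let rV_setC A : g_sigma_preimage coord A -> g_sigma_preimage coord (~` A).
Proof. exact: sigma_algebraC. Qed.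

Let rV_bigcup (F : (set 'rV[R]_n)^nat) :
  (forall i, g_sigma_preimage coord (F i)) ->
  g_sigma_preimage coord (\bigcup_i (F i)).
Proof. exact: sigma_algebra_bigcup. Qed.

HB.instance Definition _ := @isMeasurable.Build default_measure_display
  'rV[R]_n (g_sigma_preimage coord) rV_set0 rV_setC rV_bigcup.

Lemma measurable_coord (i : 'I_n) :
  measurable_fun [set: 'rV[R]_n] (fun x : 'rV[R]_n => x ord0 i).
Proof.
move=> _ Y mY; rewrite setTI; apply: sub_sigma_algebra => /=.
rewrite -bigcup_seq/=; exists i => /=; first by rewrite mem_index_enum.
by exists Y => //; rewrite setTI.
Qed.

Lemma measurable_rVP d (T : measurableType d) (f : T -> 'rV[R]_n) :
  (forall i, measurable_fun [set: T] (fun t => f t ord0 i)) ->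
  measurable_fun [set: T] f.
Proof.
move=> mf; apply: (@measurability _ _ _ _ _ f
  (\big[setU/set0]_(i < n) preimage_set_system setT (coord i) measurable)) => //.
move=> _ [B + <-]; rewrite -bigcup_seq/= => -[i _ [A mA <-]].
by rewrite setTI; have := mf i measurableT A mA; rewrite !setTI.
Qed.

End rV_measurable.

Section lebesgue_step.
Context (R : realType) (n : nat).

Definition rV_cons (p : 'rV[R]_n * measurableTypeR R) : 'rV[R]_n.+1 :=
  row_mx ((p.2 : R)%:M : 'rV[R]_1) p.1.

Lemma rV_cons0 p : rV_cons p ord0 ord0 = p.2.
Proof.
have -> : (ord0 : 'I_n.+1) = lshift n (ord0 : 'I_1) by exact: val_inj.
by rewrite /rV_cons (@row_mxEl R 1 1 n) mxE eqxx mulr1n.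
Qed.

Lemma rV_consS p (j : 'I_n) : rV_cons p ord0 (lift ord0 j) = p.1 ord0 j.
Proof.
have -> : lift ord0 j = rshift 1 j by exact: val_inj.
by rewrite /rV_cons (@row_mxEr R 1 1 n).
Qed.

Lemma measurable_rV_cons : measurable_fun setT rV_cons.
Proof.
apply: measurable_rVP => i; have [j ->|->] := unliftP ord0 i.
- under eq_fun do rewrite rV_consS.
  exact: (measurableT_comp (measurable_coord j)).
- under eq_fun do rewrite rV_cons0.
  exact: measurable_snd.
Qed.

HB.instance Definition _ := isMeasurableFun.Build _ _ _ _ rV_cons
  measurable_rV_cons.

Variable mu : {measure set 'rV[R]_n -> \bar R}.

Definition leb_step : set 'rV[R]_n.+1 -> \bar R :=
  pushforward (mu \x @lebesgue_measure R)%E rV_cons.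

Let leb_step0 : leb_step set0 = 0%E.
Proof. exact: measure0. Qed.

Let leb_step_ge0 A : (0 <= leb_step A)%E.
Proof. exact: measure_ge0. Qed.

Let leb_step_sigma_additive : semi_sigma_additive leb_step.
Proof. exact: measure_semi_sigma_additive. Qed.

HB.instance Definition _ := isMeasure.Build _ _ _ leb_step
  leb_step0 leb_step_ge0 leb_step_sigma_additive.

End lebesgue_step.

Fixpoint leb (R : realType) (n : nat) : {measure set 'rV[R]_n -> \bar R} :=
  match n return {measure set 'rV[R]_n -> \bar R} with
  | 0 => dirac (0 : 'rV[R]_0)
  | k.+1 => leb_step (leb R k)
  end.

Lemma leb_box (R : realType) (n : nat) (A : 'I_n -> set R) :
  (forall i, measurable (A i)) ->
  leb R n [set x : 'rV[R]_n | forall i, A i (x ord0 i)] =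
  (\prod_(i < n) @lebesgue_measure R (A i))%E.
Proof.
elim: n A => [|n IHn] A mA.
  rewrite big_ord0 /= diracE mem_set//= => -[].
  by [].
have mbox : measurable [set x : 'rV[R]_n | forall i, A (lift ord0 i) (x ord0 i)].
  have -> : [set x : 'rV[R]_n | forall i, A (lift ord0 i) (x ord0 i)] =
      \bigcap_(i in [set: 'I_n]) ((fun x : 'rV[R]_n => x ord0 i) @^-1` A (lift ord0 i)).
    by apply/seteqP; split => x /= h i; [move=> _|]; apply: h.
  apply: fin_bigcap_measurable; first exact: finite_finset.
  by move=> i _; rewrite -[X in measurable X]setTI; apply: measurable_coord.
rewrite big_ord_recl /= /leb_step /pushforward.
have -> : @rV_cons R n @^-1` [set x : 'rV[R]_n.+1 | forall i, A i (x ord0 i)] =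
    [set x : 'rV[R]_n | forall i, A (lift ord0 i) (x ord0 i)] `*` A ord0.
  apply/seteqP; split=> p /=.
  - move=> h; split; first by move=> i; rewrite -rV_consS.
    by rewrite -rV_cons0.
  - case=> h h0 i; have [j ->|->] := unliftP ord0 i; first by rewrite rV_consS.
    by rewrite rV_cons0.
rewrite product_measure1E//; last exact: mA.
by rewrite muleC; congr (_ * _)%E; exact: IHn.
Qed.

Section notions.
Context (R : realType) (n : nat).
Local Notation Rn := 'rV[R]_n.
Local Notation mu := (leb R n).
Implicit Types (f b v w K : Rn -> R) (c x y z : Rn) (a rho : R).

(* The norm of the library on 'rV[R]_n is the sup norm. *)
Definition enorm x : R := Num.sqrt (\sum_(i < n) x ord0 i ^+ 2).

Definition eball c rho : set Rn := [set x | enorm (x - c) < rho].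

Definition vol (B : set Rn) : R := fine (mu B).

Definition mean (B : set Rn) f : R := (vol B)^-1 * \int[mu]_(x in B) f x.

Definition loc_integrable f : Prop :=
  forall c rho, 0 < rho -> mu.-integrable (eball c rho) (EFin \o f).

Definition weight w : Prop := loc_integrable w /\ {ae mu, forall x, 0 < w x}.

Definition inv_sup w (B : set Rn) : \bar R :=
  'N[mu]_+oo[EFin \o (fun x => (w x)^-1 * \1_B x)].

Definition Lw_seminorm w (beta : R) f : \bar R :=
  ereal_sup [set t | exists c rho, 0 < rho /\
    t = (let B := eball c rho in
         inv_sup w B * ((vol B `^ (1 + beta))^-1)%:E
         * \int[mu]_(x in B) `|f x - mean B f|%:E)%E].

Definition Lip (delta : R) b : Prop :=
  exists C : R, forall x y, `|b x - b y| <= C * enorm (x - y) `^ delta.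

Definition Lip_norm (delta : R) b : R :=
  inf [set C : R | forall x y, `|b x - b y| <= C * enorm (x - y) `^ delta].

(* The factor (int ...)^{1/r'} of the class H; [a] stands for tilde alpha. *)
Definition H_factor (r : \bar R) (a delta : R) v c rho : \bar R :=
  let s := vol (eball c rho) `^ n%:R^-1 in
  if r == 1%E then
    'N[mu]_+oo[EFin \o
      (fun y => v y * (s + enorm (c - y)) `^ (- (n%:R - a + delta)))%R]%E
  else
    let r' := fine (hoelder_conjugate r) in
    ((\int[mu]_y (v y `^ r'
        / (s + enorm (c - y)) `^ (r' * (n%:R - a + delta)))%:E) `^ r'^-1)%E.

Definition H_class (r : \bar R) (a delta deltat : R) v w : Prop :=
  (ereal_sup [set t | exists c rho, (0 < rho)%R /\
    t = inv_sup w (eball c rho)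
        * (vol (eball c rho) `^ ((delta - deltat) / n%:R))%:E
        * H_factor r a delta v c rho] < +oo)%E.

Definition size_cond (alpha : R) K : Prop :=
  exists C : R, 0 < C /\
    forall x, x <> 0 -> `|K x| <= C * enorm x `^ (alpha - n%:R).

Definition smooth_cond (alpha gamma : R) K : Prop :=
  exists C : R, 0 < C /\
    forall x x' y, 2 * enorm (x - x') <= enorm (x - y) ->
      `|K (x - y) - K (x' - y)| + `|K (y - x) - K (y - x')|
      <= C * (enorm (x - x') `^ gamma
              / enorm (x - y) `^ (n%:R - alpha + gamma)).

Definition frac_op K f : Rn -> R := fun x => \int[mu]_y (K (x - y) * f y).

Definition bracket b (S : (Rn -> R) -> (Rn -> R)) : (Rn -> R) -> (Rn -> R) :=
  fun f x => b x * S f x - S (b \* f) x.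

Definition commutator K b (m : nat) : (Rn -> R) -> (Rn -> R) :=
  iter m (bracket b) (frac_op K).

(* Domains: T f is defined when the integral converges absolutely at a.e. point,
   and [b, S] f when both S f and S (b f) are.  Outside of these domains the
   total integral of the library returns a junk value. *)
Definition frac_op_dom K f : Prop :=
  {ae mu, forall x, mu.-integrable setT (fun y => (K (x - y) * f y)%:E)}.

Definition bracket_dom b (D : (Rn -> R) -> Prop) : (Rn -> R) -> Prop :=
  fun f => D f /\ D (b \* f).

Definition commutator_dom K b (m : nat) : (Rn -> R) -> Prop :=
  iter m (bracket_dom b) (frac_op_dom K).

(* For a general f with f / v in L^r the integrals defining T^m f may diverge
   at infinity, and T^m f is then meaningful only modulo additive constants,
   which the seminorm does not see: F is a version of T^m f when the truncations
   T^m (f 1_{B(0,k)}), each corrected by a constant, converge to F a.e.  Two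
   versions differ by a constant a.e., and when f is in the domain T^m f itself
   is one, with a_ = 0, by dominated convergence. *)
Definition commutator_mod_const K b (m : nat) f (F : Rn -> R) : Prop :=
  exists a_ : nat -> R, {ae mu, forall x,
    (fun k : nat => commutator K b m (f \* \1_(eball 0 k%:R)) x - a_ k)
      @ \oo --> F x}.

End notions.

(* Main.v *)
From HB Require Import structures.
Require Import Defs.
From mathcomp Require Import all_boot all_order all_algebra.
From mathcomp Require Import all_classical all_reals all_analysis.
From mathcomp Require Import measurable_realfun ess_sup_inf ring lra.
Set Implicit Arguments.
Unset Strict Implicit.
Import Order.TTheory GRing.Theory Num.Theory.
Import numFieldNormedType.Exports.
Local Open Scope classical_set_scope.
Local Open Scope ring_scope.

(* Fix a ball B of centre c and radius rho, and write
   P(x, y) = K(x - y) (b x - b y)^m.  Subtracting P(c, y) from P(x, y) for y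
   outside 2B gives a kernel Q that, up to constants, is at most
   ||b||^m |x - y|^(alphat - n) for y in 2B, and, by the smoothness of K and
   the Hoelder continuity of b, at most
   ||b||^m rho^delta |c - y|^(-(n - alphat + delta)) for y outside 2B.
   Tonelli's theorem then bounds the integral over B of |Q f| by
   ||b||^m rho^(n + delta) J with
   J = int |f y| (|B|^(1/n) + |c - y|)^(-(n - alphat + delta)) dy, and Hoelder's
   inequality bounds J by ||f/v||_r times the factor of the class H.  Any version
   of T^m f differs a.e. on B from x |-> int Q(x, y) f y dy by a constant, so its
   mean oscillation on B is at most twice that bound.  When the integral
   defining T^m f diverges, Q for the unit ball centred at 0 yields a version. *)

(** * The Euclidean norm and the measurability of its open sets *)

Section enorm.
Context {R : realType} {n : nat}.
Implicit Types (x y z c : 'rV[R]_n) (rho e : R).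

(** The subtraction is confined to the complement of 2B because P(c, y) may itself be singular at y
    = c; on 2B the positive order alphat makes the bound on P integrable in x over B. The smoothness
    of [K] has order gamma, that of [b] only order delta: as rho <= |c - y| and delta < gamma, both
    are used at order delta, which is the decay built into the class H. The powers then match:
    rho^(n + delta) is comparable to |B|^(1 + delta/n), and division by |B|^(1 + deltat/n) leaves
    the factor |B|^((delta - deltat)/n) of that class. No integral against Q is known to converge
    beforehand: Tonelli's theorem is applied to absolute values, and a finite double integral gives
    absolute convergence at almost every x. Both halves of the conclusion come from one estimate for
    integrals of (P(x, y) - g(y)) f(y), with g = 0 for the commutator on its domain and g a far
    kernel for the renormalised version. Of Lebesgue measure itself only volumes of boxes and
    Tonelli's theorem are used: balls are compared with cubes, and dyadic balls replace polar
    coordinates. *)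

Lemma enorm_ge0 x : 0 <= enorm x.
Proof. exact: sqrtr_ge0. Qed.

Lemma sqr_enorm x : enorm x ^+ 2 = \sum_(i < n) x ord0 i ^+ 2.
Proof. by rewrite sqr_sqrtr// sumr_ge0// => i _; exact: sqr_ge0. Qed.

Lemma enormN x : enorm (- x) = enorm x.
Proof. by congr Num.sqrt; apply: eq_bigr => i _; rewrite mxE sqrrN. Qed.

Lemma enormB x y : enorm (x - y) = enorm (y - x).
Proof. by rewrite -enormN opprB. Qed.

Lemma enorm0 : enorm (0 : 'rV[R]_n) = 0.
Proof. by rewrite /enorm big1 ?sqrtr0// => i _; rewrite mxE expr0n. Qed.

Lemma coord_le_enorm x i : `|x ord0 i| <= enorm x.
Proof.
rewrite -sqrtr_sqr ler_wsqrtr// (bigD1 i)//= lerDl sumr_ge0// => j _.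
exact: sqr_ge0.
Qed.

Lemma enorm_le_coord x e : (forall i, `|x ord0 i| <= e) -> enorm x <= n%:R * e.
Proof.
move=> xe; case: n x xe => [x _|k x xe].
  by rewrite mul0r /enorm big_ord0 sqrtr0.
have e0 : 0 <= e by apply: le_trans (xe ord0).
have x0 : 0 <= enorm x by exact: sqrtr_ge0.
rewrite -(@ler_pXn2r _ 2) ?nnegrE ?mulr_ge0//.
rewrite sqr_sqrtr; last by rewrite sumr_ge0// => i _; exact: sqr_ge0.
apply: (@le_trans _ _ (\sum_(i < k.+1) e ^+ 2)).
  by apply: ler_sum => i _; rewrite -real_normK ?num_real// lerXn2r ?nnegrE.
rewrite sumr_const card_ord -[X in X <= _]mulr_natl exprMn.
by rewrite ler_wpM2r ?sqr_ge0// expr2 ler_peMl ?ler1n.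
Qed.

Lemma enorm_gt0 x : x <> 0 -> 0 < enorm x.
Proof.
move=> x0; rewrite lt_neqAle enorm_ge0 andbT; apply/eqP => ex.
apply: x0; apply/rowP => i; rewrite mxE; apply/eqP; rewrite -normr_le0 ex.
exact: coord_le_enorm.
Qed.

(** The polynomial |x - t y|^2 in t is nonnegative. It is evaluated at its minimiser t = S/Y or, if
    Y = 0, at t = (X + 1)/S, where it would equal -X - 2. *)
Lemma cauchy_schwarz x y :
  \sum_(i < n) x ord0 i * y ord0 i <= enorm x * enorm y.
Proof.
set S := \sum_(i < n) _.
have [S0|S0] := leP S 0; first by rewrite (le_trans S0)// mulr_ge0 ?enorm_ge0.
rewrite -(@ler_pXn2r _ 2) ?nnegrE ?mulr_ge0 ?enorm_ge0 ?(ltW S0)//.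
rewrite exprMn !sqr_enorm.
set X := \sum_(i < n) x _ _ ^+ 2; set Y := \sum_(i < n) y _ _ ^+ 2.
have H t : 0 <= X - t * (S + S) + t ^+ 2 * Y.
  rewrite -big_split/= !mulr_sumr -sumrB -big_split/= sumr_ge0// => i _.
  have -> : x ord0 i ^+ 2 -
      t * (x ord0 i * y ord0 i + x ord0 i * y ord0 i) +
      t ^+ 2 * y ord0 i ^+ 2 = (x ord0 i - t * y ord0 i) ^+ 2 by ring.
  exact: sqr_ge0.
have Y0 : 0 <= Y by rewrite sumr_ge0// => i _; exact: sqr_ge0.
have [Y00|Yp] := eqVneq Y 0.
  have X0 : 0 <= X by rewrite sumr_ge0// => i _; exact: sqr_ge0.
  have := H ((X + 1) / S); rewrite Y00 mulr0 addr0.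
  have -> : X - (X + 1) / S * (S + S) = X - 2 * (X + 1).
    by field; rewrite gt_eqF.
  by lra.
have {}Yp : 0 < Y by rewrite lt_neqAle eq_sym Yp.
have := H (S / Y).
have -> : X - S / Y * (S + S) + (S / Y) ^+ 2 * Y = X - S ^+ 2 / Y.
  by field; rewrite gt_eqF.
by rewrite subr_ge0 ler_pdivrMr.
Qed.

Lemma enormD x y : enorm (x + y) <= enorm x + enorm y.
Proof.
rewrite -(@ler_pXn2r _ 2) ?nnegrE ?addr_ge0 ?enorm_ge0//.
rewrite sqrrD !sqr_enorm.
have h := cauchy_schwarz x y.
rewrite [X in X <= _](_ : _ = \sum_(i < n) x ord0 i ^+ 2 +
    (\sum_(i < n) x ord0 i * y ord0 i) *+ 2 + \sum_(i < n) y ord0 i ^+ 2).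
  by rewrite lerD2r lerD2l lerMn2r h.
rewrite -sumrMnl -!big_split/=; apply: eq_bigr => i _.
by rewrite mxE sqrrD.
Qed.

Lemma enorm_triangle z x y : enorm (x - y) <= enorm (x - z) + enorm (z - y).
Proof. by rewrite -[X in enorm X](_ : (x - z) + (z - y) = _) ?enormD// addrA subrK. Qed.

Lemma le_eball c rho rho' : rho <= rho' -> eball c rho `<=` eball c rho'.
Proof. by move=> r x /= /lt_le_trans; apply. Qed.

(** Openness is phrased with Euclidean balls, so that no comparison with the topology of the sup
    norm is needed. *)
Definition enorm_open (S : set 'rV[R]_n) :=
  forall x, S x -> exists2 e, 0 < e & eball x e `<=` S.

(** An open set is the union of the cubes with rational centres and sides that it contains, and
    these are countably many. *)
Lemma measurable_enorm_open S : enorm_open S -> measurable S.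
Proof.
move=> oS.
pose box (p : {ffun 'I_n -> rat} * nat) :=
  [set x : 'rV[R]_n | forall i, `|x ord0 i - ratr (p.1 i)| < p.2.+1%:R^-1].
have mbox p : measurable (box p).
  have -> : box p = \bigcap_(i in [set: 'I_n])
      ((fun x : 'rV[R]_n => x ord0 i) @^-1`
         [set t | `|t - ratr (p.1 i)| < p.2.+1%:R^-1]).
    by apply/seteqP; split => x /= h i; [move=> _|]; exact: h.
  apply: fin_bigcap_measurable; first exact: finite_finset.
  move=> i _; rewrite -[X in measurable X]setTI.
  apply: measurable_coord => //.
  rewrite [X in measurable X](_ : _ = `](ratr (p.1 i) - p.2.+1%:R^-1),
      (ratr (p.1 i) + p.2.+1%:R^-1)[%classic); first exact: measurable_itv.
  by apply/seteqP; split => t /=; rewrite in_itv/= ltr_distl.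
pose F p := if pselect (box p `<=` S) then box p else set0.
have -> : S = \bigcup_p F p.
  apply/seteqP; split => [x Sx|x [p _]]; last first.
    by rewrite /F; case: pselect => // /[apply].
  have [e e0 eS] := oS _ Sx.
  (* A cube of half-side 1/(N+1), whose centre is within 1/(N+1) of x in each coordinate, stays
     within 2n/(N+1) of x. *)
  have [N HN] : exists N : nat, N.+1%:R^-1 *+ 2 * n%:R < e.
    exists (Num.trunc (e^-1 * (n%:R * 2))); set N := Num.trunc _.
    have -> : N.+1%:R^-1 *+ 2 * n%:R = n%:R * 2 / N.+1%:R :> R by ring.
    by rewrite ltr_pdivrMr ?ltr0n// -ltr_pdivrMl// truncnS_gt.
  have /choice[q Hq] : forall i, exists q : rat,
      `|x ord0 i - ratr q| < N.+1%:R^-1.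
    move=> i; have [q] := @rat_in_itvoo R (x ord0 i - N.+1%:R^-1) (x ord0 i)
      ltac:(by rewrite ltrBlDr ltrDl invr_gt0).
    rewrite in_itv/= => /andP[q1 q2]; exists q.
    by rewrite gtr0_norm ?subr_gt0// ltrBlDr addrC -ltrBlDr.
  have boxS : box ([ffun i => q i], N) `<=` S.
    move=> y yb; apply: eS; rewrite /eball/=.
    apply: le_lt_trans HN; rewrite mulrC; apply: enorm_le_coord => i.
    rewrite !mxE -(subrKA (ratr (q i))) mulr2n (le_trans (ler_normD _ _))//.
    apply: lerD; first by have := yb i; rewrite /= ffunE => /ltW.
    by rewrite distrC ltW.
  exists ([ffun i => q i], N) => //; rewrite /F; case: pselect => // _ i.
  by rewrite /= ffunE.
apply: countable_bigcupT_measurable => [|p]; first exact: countableP.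
by rewrite /F; case: pselect => [?|?]; [exact: mbox|exact: measurable0].
Qed.

Lemma enorm_open_eball c rho : enorm_open (eball c rho).
Proof.
move=> x xc; exists (rho - enorm (x - c)); first by rewrite subr_gt0.
move=> y; rewrite /eball/= => yx; apply: le_lt_trans (enorm_triangle x _ _) _.
by rewrite -ltrBrDr.
Qed.

Lemma measurable_eball c rho : measurable (eball c rho).
Proof. by apply: measurable_enorm_open; exact: enorm_open_eball. Qed.

(** The origin is exempt because [K] may be singular there. A point is measurable, so a superlevel
    set splits into its part at 0 and an open set. *)
Lemma measurable_fun_enorm_continuous_off0 (g : 'rV[R]_n -> R) :
  (forall x, x <> 0 -> forall e, 0 < e ->
     exists2 d, 0 < d & forall y, enorm (y - x) < d -> `|g y - g x| < e) ->
  measurable_fun setT g.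
Proof.
move=> cg _; apply: (measurability _ (RGenOInfty.measurableE R)) => //.
move=> /= _ [_ [a ->] <-]; rewrite setTI preimage_itvoy.
set S := [set x | a < g x].
have m0 : measurable [set (0 : 'rV[R]_n)].
  rewrite (_ : [set 0] = \bigcap_(i in [set: 'I_n])
      ((fun x : 'rV[R]_n => x ord0 i) @^-1` [set 0])).
    apply: fin_bigcap_measurable; first exact: finite_finset.
    by move=> i _; rewrite -[X in measurable X]setTI; exact: measurable_coord.
  apply/seteqP; split => x /=; first by move=> -> i _ /=; rewrite mxE.
  by move=> h; apply/rowP => i; rewrite mxE h.
rewrite -(setUIDK S [set 0]); apply: measurableU.
  have [g0|g0] := pselect (S 0).
    by rewrite (_ : _ `&` _ = [set 0])//; apply/setIidPr => x ->.
  rewrite (_ : _ `&` _ = set0)//.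
  by apply/seteqP; split => // x [+ x0]; rewrite x0.
apply: measurable_enorm_open => x [/= Sx x0].
have e0 : 0 < g x - a by rewrite subr_gt0.
have [d d0 Hd] := cg x x0 _ e0.
exists (Num.min d (enorm x)); first by rewrite lt_min d0 enorm_gt0.
move=> y; rewrite /eball/= lt_min => /andP[yd yx]; split.
  have := Hd _ yd; rewrite ltr_norml /S/= => /andP[h1 h2].
  by lra.
by move=> y0; move: yx; rewrite y0 sub0r enormN ltxx.
Qed.

End enorm.

(** * Monotonicity and exponent laws of real powers *)

Section powR_lemmas.
Context {R : realType}.
Implicit Types (x y p q : R).

Lemma ler_powRl x y p : 0 <= p -> 0 <= x -> x <= y -> x `^ p <= y `^ p.
Proof.
by move=> p0 x0 xy; apply: ge0_ler_powR; rewrite // nnegrE// (le_trans x0).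
Qed.

Lemma ler_powRN x y p : 0 <= p -> 0 < x -> x <= y -> y `^ (- p) <= x `^ (- p).
Proof.
move=> p0 x0 xy; have y0 := lt_le_trans x0 xy.
rewrite !powRN lef_pV2 ?posrE ?powR_gt0//.
by apply: ler_powRl => //; exact: ltW.
Qed.

Lemma powRDp x p q : 0 < x -> x `^ (p + q) = x `^ p * x `^ q.
Proof. by move=> x0; rewrite powRD // (gt_eqF x0) implybT. Qed.

Lemma powRpMn x p (m : nat) : x `^ (m%:R * p) = x `^ p ^+ m.
Proof. by rewrite mulrC powRrM powR_mulrn ?powR_ge0. Qed.

End powR_lemmas.

(** * Volumes of balls, by comparison with cubes *)

Section leb_balls.
Context {R : realType} {n : nat}.
Local Notation mu := (leb R n).
Implicit Types (c x y : 'rV[R]_n) (rho e : R).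

Lemma leb_cube c e : 0 <= e ->
  mu [set x | forall i, x ord0 i \in `](c ord0 i - e), (c ord0 i + e)[] =
  ((2 * e) ^+ n)%:E.
Proof.
move=> e0.
rewrite (leb_box (A := fun i => `](c ord0 i - e), (c ord0 i + e)[%classic))//.
rewrite (eq_bigr (fun=> (2 * e)%:E)).
  by rewrite prodEFin prodr_const card_ord.
move=> i _; rewrite lebesgue_measure_itv/= lte_fin.
case: ifPn => [_|]; first by rewrite -EFinD; congr EFin; ring.
rewrite -leNgt => h; congr EFin.
have -> : e = 0 by apply/eqP; rewrite eq_le e0 andbT; lra.
by rewrite mulr0.
Qed.

Lemma measurable_cube c e :
  measurable [set x : 'rV[R]_n |
    forall i, x ord0 i \in `](c ord0 i - e), (c ord0 i + e)[].
Proof.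
rewrite (_ : mkset _ = \bigcap_(i in [set: 'I_n]) ((fun x : 'rV[R]_n => x ord0 i)
    @^-1` `](c ord0 i - e), (c ord0 i + e)[%classic)).
  apply: fin_bigcap_measurable; first exact: finite_finset.
  move=> i _; rewrite -[X in measurable X]setTI.
  by apply: measurable_coord => //; exact: measurable_itv.
by apply/seteqP; split => x /= h i; [move=> _|]; exact: h.
Qed.

Lemma leb_eball_le c rho : 0 <= rho -> (mu (eball c rho) <= ((2 * rho) ^+ n)%:E)%E.
Proof.
move=> r0; rewrite -(leb_cube c r0); apply: le_measure.
- by rewrite inE; exact: measurable_eball.
- by rewrite inE; exact: measurable_cube.
- move=> x xc i; rewrite in_itv/= -ltr_distl.
  by rewrite (le_lt_trans _ xc)// (le_trans _ (coord_le_enorm _ i))// !mxE.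
Qed.

(** The half-side rho/(n+1), rather than rho/n, gives n rho/(n+1) < rho, so the cube fits in the
    open ball. *)
Lemma leb_eball_ge c rho : 0 < rho ->
  (((2 * (rho / n.+1%:R)) ^+ n)%:E <= mu (eball c rho))%E.
Proof.
move=> r0; have e0 : 0 < rho / n.+1%:R by rewrite divr_gt0.
rewrite -(leb_cube c (ltW e0)); apply: le_measure.
- by rewrite inE; exact: measurable_cube.
- by rewrite inE; exact: measurable_eball.
- move=> x xc; rewrite /eball/=.
  apply: (@le_lt_trans _ _ (n%:R * (rho / n.+1%:R))).
    apply: enorm_le_coord => i; rewrite !mxE ltW//.
    by have := xc i; rewrite in_itv/= ltr_distl.
  by rewrite mulrCA gtr_pMr// ltr_pdivrMr// mul1r ltr_nat.
Qed.

Lemma leb_eball_lty c rho : (mu (eball c rho) < +oo)%E.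
Proof.
apply: (@le_lt_trans _ _ (mu (eball c (Num.max 0 rho)))).
  apply: le_measure; rewrite ?inE; [exact: measurable_eball..|].
  by apply: le_eball; rewrite le_max lexx orbT.
by apply: (le_lt_trans (leb_eball_le _ _)); rewrite ?ltry// le_max lexx.
Qed.

Lemma leb_eball_fin_num c rho : mu (eball c rho) \is a fin_num.
Proof. by rewrite ge0_fin_numE ?leb_eball_lty. Qed.

Lemma leb_eball_gt0 c rho : 0 < rho -> (0 < mu (eball c rho))%E.
Proof.
move=> r0; apply: lt_le_trans (leb_eball_ge c r0).
by rewrite lte_fin exprn_gt0// mulr_gt0// divr_gt0.
Qed.

Lemma leb_setT_gt0 : (0 < mu setT)%E.
Proof.
apply: (@lt_le_trans _ _ (mu (eball 0 1))); first exact: leb_eball_gt0.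
by apply: le_measure; rewrite ?inE//; exact: measurable_eball.
Qed.

Lemma volE c rho : (vol (eball c rho))%:E = mu (eball c rho).
Proof. by rewrite /vol fineK ?leb_eball_fin_num. Qed.

Lemma vol_gt0 c rho : 0 < rho -> 0 < vol (eball c rho).
Proof. by move=> r0; rewrite -lte_fin volE leb_eball_gt0. Qed.

Lemma vol_le c rho : 0 <= rho -> vol (eball c rho) <= (2 * rho) ^+ n.
Proof. by move=> r0; rewrite -lee_fin volE leb_eball_le. Qed.

Lemma vol_ge c rho : 0 < rho -> (2 * (rho / n.+1%:R)) ^+ n <= vol (eball c rho).
Proof. by move=> r0; rewrite -lee_fin volE leb_eball_ge. Qed.

Lemma ae_eballP (P : 'rV[R]_n -> Prop) c rho : 0 < rho ->
  {ae mu, forall x, eball c rho x -> P x} -> exists2 x, eball c rho x & P x.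
Proof.
move=> r0 aeP; apply: contrapT => nP.
have : mu (eball c rho) = 0%E.
  apply: measure_negligible; first exact: measurable_eball.
  case: aeP => N [mN N0 sN]; exists N; split => // x xB; apply: sN => /= Px.
  by apply: nP; exists x => //; exact: Px.
by apply/eqP; rewrite gt_eqF// leb_eball_gt0.
Qed.

Lemma bigcup_eball : \bigcup_k eball (0 : 'rV[R]_n) k%:R = setT.
Proof.
apply/seteqP; split => // x _; exists (Num.trunc (enorm x)).+1 => //.
by rewrite /eball/= subr0 truncnS_gt.
Qed.

Lemma leb_sigma_finite : sigma_finite setT mu.
Proof.
exists (fun k => eball 0 k%:R); first by rewrite bigcup_eball.
by move=> k; split; [exact: measurable_eball|exact: leb_eball_lty].
Qed.

Lemma ae_eball_foralln (P : 'rV[R]_n -> Prop) :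
  (forall k : nat, {ae mu, forall x, eball 0 k%:R x -> P x}) ->
  {ae mu, forall x, P x}.
Proof.
move=> H; have := ae_foralln H; apply: filterS => x Hx.
have : [set: 'rV[R]_n] x by [].
by rewrite -bigcup_eball => -[k _ xk]; exact: Hx xk.
Qed.

End leb_balls.

(** * Tonelli's theorem and measurability of integrals with a parameter *)

Section fubini_leb.
Context {R : realType} {n : nat}.
Local Notation Rn := 'rV[R]_n.
Local Notation mu := (leb R n).

(* A copy of [leb R n] carrying the sigma-finite structure: the integrals
   against it are convertible with those against [leb R n]. *)
Let lebs : set Rn -> \bar R := mu.
HB.instance Definition _ := Measure.on lebs.
HB.instance Definition _ := @Measure_isSigmaFinite.Build _ _ _ lebs (@leb_sigma_finite R n).

Lemma leb_tonelli (f : Rn * Rn -> \bar R) : measurable_fun setT f ->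
  (forall p, 0 <= f p)%E ->
  (\int[mu]_x \int[mu]_y f (x, y) = \int[mu]_y \int[mu]_x f (x, y))%E.
Proof. exact: (@fubini_tonelli _ _ _ _ _ lebs lebs f). Qed.

Lemma measurable_leb_integral (f : Rn * Rn -> \bar R) : measurable_fun setT f ->
  (forall p, 0 <= f p)%E -> measurable_fun setT (fun x => \int[mu]_y f (x, y))%E.
Proof. by move=> mf f0; exact: (@measurable_fun_fubini_tonelli_F _ _ _ _ _ lebs f). Qed.

Lemma leb_tonelli_restr (A B : set Rn) (f : Rn * Rn -> \bar R) :
  measurable A -> measurable B -> measurable_fun setT f ->
  (forall p, 0 <= f p)%E ->
  (\int[mu]_(x in A) \int[mu]_(y in B) f (x, y) =
   \int[mu]_(y in B) \int[mu]_(x in A) f (x, y))%E.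
Proof.
move=> mA mB mf f0; pose g := f \_ (A `*` B).
have g0 p : (0 <= g p)%E by rewrite /g patchE; case: ifP.
have mg : measurable_fun setT g.
  apply: (proj1 (measurable_restrictT f (measurableX mA mB))).
  exact: (measurable_funS measurableT (@subsetT _ _) mf).
have E1 x : ((fun x => \int[mu]_(y in B) f (x, y)) \_ A)%E x = (\int[mu]_y g (x, y))%E.
  rewrite patchE; case: ifPn => [xA|xA].
    rewrite integral_mkcond; apply: eq_integral => y _.
    by rewrite /g !patchE in_setX xA.
  by rewrite integral0_eq// => y _; rewrite /g patchE in_setX (negbTE xA).
have E2 y : ((fun y => \int[mu]_(x in A) f (x, y)) \_ B)%E y = (\int[mu]_x g (x, y))%E.
  rewrite patchE; case: ifPn => [xA|xA].
    rewrite integral_mkcond; apply: eq_integral => x _.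
    by rewrite /g !patchE in_setX xA andbT.
  by rewrite integral0_eq// => x _; rewrite /g patchE in_setX (negbTE xA) andbF.
rewrite integral_mkcond [RHS]integral_mkcond.
under eq_integral do rewrite E1.
under [RHS]eq_integral do rewrite E2.
exact: leb_tonelli.
Qed.

(** No integrability is required: the integrals of the positive and negative parts are measurable in
    x, so is their difference even where both are infinite, and so is [fine]. The commutator is thus
    measurable outside its domain too. *)
Lemma measurable_leb_Rintegral (f : Rn * Rn -> R) : measurable_fun setT f ->
  measurable_fun setT (fun x => \int[mu]_y f (x, y)).
Proof.
move=> mf; rewrite /Rintegral.
apply: (measurableT_comp (fine_measurable _)) => //.
under eq_fun do rewrite integralE.
have mF : measurable_fun setT (EFin \o f) by exact/measurable_EFinP.
apply: emeasurable_funB.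
- have := measurable_leb_integral (measurable_funepos mF) (funepos_ge0 _).
  under eq_fun do under eq_integral do rewrite funeposE.
  by under [in X in _ -> X]eq_fun do under eq_integral do rewrite funeposE.
- have := measurable_leb_integral (measurable_funeneg mF) (funeneg_ge0 _).
  under eq_fun do under eq_integral do rewrite funenegE.
  by under [in X in _ -> X]eq_fun do under eq_integral do rewrite funenegE.
Qed.

Lemma measurable_subV : measurable_fun setT (fun p : Rn * Rn => p.1 - p.2).
Proof.
apply: measurable_rVP => i; under eq_fun do rewrite !mxE.
by apply: measurable_funB;
  apply: (measurableT_comp (measurable_coord _)).
Qed.

Lemma measurable_subVr (y : Rn) : measurable_fun setT (fun x : Rn => x - y).
Proof.
apply: measurable_rVP => i; under eq_fun do rewrite !mxE.
by apply: measurable_funB => //; exact: measurable_coord.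
Qed.

Lemma measurable_subVl (x : Rn) : measurable_fun setT (fun y : Rn => x - y).
Proof.
apply: measurable_rVP => i; under eq_fun do rewrite !mxE.
by apply: measurable_funB => //; exact: measurable_coord.
Qed.

Lemma measurable_enorm : measurable_fun setT (@enorm R n).
Proof.
apply: measurable_fun_enorm_continuous_off0 => x _ e e0; exists e => // y.
apply: le_lt_trans; rewrite ler_norml; apply/andP; split.
  have := enormD (x - y) y; rewrite subrK enormB => h; lra.
by have := enormD (y - x) x; rewrite subrK => h; lra.
Qed.

End fubini_leb.

(** * The Riesz kernel on balls *)

Section riesz_kernel.
Context {R : realType} {n : nat}.
Local Notation Rn := 'rV[R]_n.
Local Notation mu := (leb R n).
Implicit Types (c x y : Rn) (rho beta : R) (f : Rn -> R).

Lemma dyadic_shell (d rho : R) : 0 < d -> d < rho ->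
  exists k : nat, rho / 2 ^+ k.+1 <= d < rho / 2 ^+ k.
Proof.
move=> d0 dr; have r0 := lt_trans d0 dr.
have exk : exists k : nat, rho / 2 ^+ k.+1 <= d.
  exists (Num.trunc (d^-1 * rho)).
  rewrite ler_pdivrMr ?exprn_gt0// -ler_pdivrMl//.
  apply: (le_trans (ltW (truncnS_gt _))).
  by rewrite -natrX ler_nat ltnW// ltn_expl.
case: (ex_minnP exk) => -[dk _|k dk mink].
  by exists 0%N; rewrite dk expr0 divr1.
exists k.+1; rewrite dk/= ltNge; apply/negP => h.
by have := mink _ h; rewrite ltnn.
Qed.

Lemma measurable_riesz_kernel y p :
  measurable_fun setT (fun x : Rn => enorm (x - y) `^ p).
Proof.
apply: (measurableT_comp (measurable_powR p)).
exact: (measurableT_comp measurable_enorm (measurable_subVr y)).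
Qed.

Lemma geometric_nneseries_le (M q : R) : 0 <= M -> 0 < q < 1 ->
  (\sum_(k <oo) (M * q ^+ k)%:E <= (M / (1 - q))%:E)%E.
Proof.
move=> M0 /andP[q0 q1]; apply: lime_le.
  apply: is_cvg_nneseries => k _ _.
  by rewrite lee_fin mulr_ge0// exprn_ge0// ltW.
apply: nearW => N; rewrite sumEFin lee_fin.
by apply: geometric_le_lim => //; rewrite gtr0_norm.
Qed.

(** The ball is cut into dyadic shells. On shell k the kernel is at most its value at the inner
    radius, and the volume is at most a constant times (rho / 2^k)^n. The product is of order
    rho^beta 2^(-k beta), a convergent geometric series since beta > 0. *)
Lemma integral_riesz_kernel_ball beta : 0 < beta -> beta < n%:R ->
  exists2 C : R, 0 < C & forall y rho, 0 < rho ->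
    (\int[mu]_(x in eball y rho) (enorm (x - y) `^ (beta - n%:R))%:E
     <= (C * rho `^ beta)%:E)%E.
Proof.
move=> b0 bn; have p0 : 0 < n%:R - beta by rewrite subr_gt0.
set p := n%:R - beta; have -> : beta - n%:R = - p by rewrite opprB.
pose q : R := 2 `^ (- beta).
have q01 : 0 < q < 1.
  rewrite powR_gt0//= /q powRN invf_lt1 ?powR_gt0//.
  rewrite -[X in X < _](powRr0 2) /powR !gt_eqF// ltr_expR mul0r.
  by rewrite mulr_gt0// ln_gt0// ltr1n.
have q1 : 0 < 1 - q by rewrite subr_gt0; case/andP: q01.
(* The first factor comes from the ratio of the inner to the outer radius of a shell, the second
   from the volume bound (2t)^n for a ball of radius t. *)
pose D : R := (2^-1) `^ (- p) * 2 ^+ n.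
have D0 : 0 < D by rewrite mulr_gt0 ?powR_gt0 ?invr_gt0 ?exprn_gt0.
exists (D / (1 - q)); first by rewrite divr_gt0.
move=> y rho r0.
pose a k : R := (rho / 2 ^+ k.+1) `^ (- p).
pose B k := eball y (rho / 2 ^+ k).
(* [u k] is constant on the whole ball [B k], not only on its shell: this overcounts, but the bound
   stays geometric. *)
pose u k := (cst (a k)%:E : Rn -> \bar R) \_ (B k).
have u0 k x : (0 <= u k x)%E.
  by rewrite /u patchE; case: ifP => // _; rewrite lee_fin powR_ge0.
have mu_ k : measurable_fun setT (u k).
  apply: (proj1 (measurable_restrictT _ (measurable_eball _ _))).
  exact: measurable_cst.
have Iu k : (\int[mu]_x u k x <= (D * rho `^ beta * q ^+ k)%:E)%E.
  rewrite -integral_mkcond integral_cst; last exact: measurable_eball.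
  have t0 : 0 < rho / 2 ^+ k by rewrite divr_gt0 ?exprn_gt0.
  apply: (@le_trans _ _ ((a k)%:E * ((2 * (rho / 2 ^+ k)) ^+ n)%:E)%E).
    by rewrite lee_wpmul2l ?lee_fin ?powR_ge0// leb_eball_le// ltW.
  have t0' := ltW t0; have r0' := ltW r0.
  have k0 : 0 <= (2 ^+ k)^-1 :> R by rewrite invr_ge0 exprn_ge0.
  have aE : a k = (rho / 2 ^+ k) `^ (- p) * 2^-1 `^ (- p).
    by rewrite /a exprSr invfM mulrA powRM ?invr_ge0.
  rewrite -EFinM lee_fin aE exprMn.
  have -> : q ^+ k = (2 ^+ k)^-1 `^ beta.
    rewrite -[in RHS]powR_inv1 ?exprn_ge0// -powRrM mulN1r [RHS]powRN /q powRN.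
    by rewrite exprVn -powR_mulrn ?powR_ge0// powRAC powR_mulrn.
  rewrite -[_ * _ * (2 ^+ k)^-1 `^ beta]mulrA -(powRM beta r0' k0).
  have -> : (rho / 2 ^+ k) `^ beta = (rho / 2 ^+ k) `^ (- p) * (rho / 2 ^+ k) ^+ n.
    by rewrite -powR_mulrn// -powRDp// opprB subrK.
  by rewrite /D [X in X * (2 ^+ n * _)]mulrC mulrACA.
rewrite integral_mkcond.
apply: (@le_trans _ _ (\int[mu]_x \sum_(k <oo) u k x)%E).
  apply: ge0_le_integral => //.
  - by move=> x _; rewrite patchE; case: ifP => // _; rewrite lee_fin powR_ge0.
  - apply: (proj1 (measurable_restrictT _ (measurable_eball _ _))).
    apply: (measurable_funS measurableT (@subsetT _ _)).
    by apply/measurable_EFinP; exact: measurable_riesz_kernel.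
  - by apply: ge0_emeasurable_sum => [k x _ _|k _]; [exact: u0|exact: mu_].
  - move=> x _; rewrite patchE; case: ifPn => [|_]; last exact: nneseries_ge0.
    rewrite inE => xy.
    (* At x = y the kernel is 0, because [powR] sends 0 to 0 at every nonzero exponent. *)
    have [xy0|xy0] := eqVneq x y.
      rewrite xy0 subrr enorm0 powR0 ?oppr_eq0 ?gt_eqF//.
      exact: nneseries_ge0.
    have d0 : 0 < enorm (x - y).
      by apply: enorm_gt0 => /eqP; rewrite subr_eq0; exact/negP.
    have [k /andP[k1 k2]] := dyadic_shell d0 xy.
    apply: (@le_trans _ _ (u k x)).
      rewrite /u patchE mem_set// lee_fin; apply: ler_powRN => //.
        exact: ltW.
      by rewrite divr_gt0 ?exprn_gt0.
    have := @nneseries_lim_ge R (fun k => u k x) xpredT 0%N k.+1 (fun k _ _ => u0 k x).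
    apply: le_trans; rewrite big_nat_recr//= leeDr//.
    by apply: sume_ge0 => i _; exact: u0.
rewrite integral_nneseries//.
apply: (@le_trans _ _ (\sum_(k <oo) (D * rho `^ beta * q ^+ k)%:E)%E).
  by apply: lee_nneseries => // k _ _; exact: integral_ge0.
apply: (le_trans (geometric_nneseries_le _ q01)).
  by rewrite mulr_ge0 ?powR_ge0 ?ltW.
by rewrite lee_fin mulrAC.
Qed.

Lemma measurable_riesz_potential p f c rho : measurable_fun setT f ->
  measurable_fun setT (fun x => \int[mu]_(y in eball c rho)
    (enorm (x - y) `^ p * `|f y|)%:E)%E.
Proof.
move=> mf; pose g (q : Rn * Rn) : \bar R := ((fun q : Rn * Rn =>
  (enorm (q.1 - q.2) `^ p * `|f q.2|)%:E) \_ (setT `*` eball c rho)) q.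
have mg : measurable_fun setT g.
  apply: (proj1 (measurable_restrictT _ (measurableX measurableT (measurable_eball _ _)))).
  apply: (measurable_funS measurableT (@subsetT _ _)).
  apply/measurable_EFinP; apply: measurable_funM.
    apply: (measurableT_comp (measurable_powR _)).
    exact: (measurableT_comp measurable_enorm measurable_subV).
  by apply: measurableT_comp => //; exact: (measurableT_comp mf measurable_snd).
have g0 q : (0 <= g q)%E.
  by rewrite /g patchE; case: ifP => // _; rewrite lee_fin mulr_ge0// powR_ge0.
rewrite (_ : (fun x => _) = fun x => \int[mu]_y g (x, y))%E.
  exact: (measurable_leb_integral mg g0).
apply/funext => x; rewrite integral_mkcond; apply: eq_integral => y _.
by rewrite /g !patchE in_setX in_setT.
Qed.

(** Tonelli's theorem lets the kernel be integrated first in x. For y in 2B the ball B lies in the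
    ball of radius 3 rho about y, whence the factor 3^beta. *)
Lemma riesz_potential_near beta : 0 < beta -> beta < n%:R ->
  exists2 C : R, 0 < C & forall f c rho, measurable_fun setT f -> 0 < rho ->
    (\int[mu]_(x in eball c rho) \int[mu]_(y in eball c (2 * rho))
       (enorm (x - y) `^ (beta - n%:R) * `|f y|)%:E
     <= (C * rho `^ beta)%:E * \int[mu]_(y in eball c (2 * rho)) (`|f y|)%:E)%E.
Proof.
move=> b0 bn; have [C C0 HC] := integral_riesz_kernel_ball b0 bn.
exists (C * 3 `^ beta); first by rewrite mulr_gt0 ?powR_gt0.
move=> f c rho mf r0.
have mf2 : measurable_fun setT (fun p : Rn * Rn =>
    (enorm (p.1 - p.2) `^ (beta - n%:R) * `|f p.2|)%:E).
  apply/measurable_EFinP/measurable_funM.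
    apply: (measurableT_comp (measurable_powR _)).
    exact: (measurableT_comp measurable_enorm measurable_subV).
  apply: measurableT_comp => //.
  exact: (measurableT_comp mf measurable_snd).
rewrite (leb_tonelli_restr (measurable_eball _ _) (measurable_eball _ _) mf2)/=;
  last by move=> p; rewrite lee_fin mulr_ge0 ?powR_ge0.
rewrite -ge0_integralZl//=; last 3 first.
- exact: measurable_eball.
- apply: (measurable_funS measurableT (@subsetT _ _)).
  by apply/measurable_EFinP; apply: measurableT_comp.
- by rewrite lee_fin !mulr_ge0 ?powR_ge0// ltW.
have K0 y x : (0 <= (enorm (x - y) `^ (beta - n%:R))%:E :> \bar R)%E.
  by rewrite lee_fin powR_ge0.
have mK y A : measurable_fun A (fun x => (enorm (x - y) `^ (beta - n%:R))%:E : \bar R).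
  apply: (measurable_funS measurableT (@subsetT _ _)).
  by apply/measurable_EFinP; exact: measurable_riesz_kernel.
have -> : (\int[mu]_(y in eball c (2 * rho)) \int[mu]_(x in eball c rho)
    (enorm (x - y) `^ (beta - n%:R) * `|f y|)%:E =
  \int[mu]_(y in eball c (2 * rho)) (`|f y|%:E * \int[mu]_(x in eball c rho)
    (enorm (x - y) `^ (beta - n%:R))%:E))%E.
  apply: eq_integral => y _; rewrite -ge0_integralZl//.
  - by apply: eq_integral => x _; rewrite -EFinM mulrC.
  - exact: measurable_eball.
apply: ge0_le_integral; first exact: measurable_eball.
- by move=> y _; rewrite mule_ge0 ?lee_fin//; apply: integral_ge0 => x _.
- apply: (measurable_funS measurableT (@subsetT _ _)).
  apply: emeasurable_funM.
    by apply/measurable_EFinP; apply: measurableT_comp.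
  under eq_fun do rewrite integral_mkcond.
  pose g := (fun p : Rn * Rn => (enorm (p.2 - p.1) `^ (beta - n%:R))%:E)
    \_ (setT `*` eball c rho).
  have mg : measurable_fun setT g.
    apply: (proj1 (measurable_restrictT _ (measurableX measurableT (measurable_eball _ _)))).
    apply: (measurable_funS measurableT (@subsetT _ _)).
    apply/measurable_EFinP.
    apply: (measurableT_comp (measurable_powR _)).
    apply: (measurableT_comp measurable_enorm).
    under eq_fun do rewrite -opprB.
    apply: measurable_rVP => i; under eq_fun do rewrite mxE.
    apply: measurableT_comp => //.
    exact: (measurableT_comp (measurable_coord i) measurable_subV).
  have g0 p : (0 <= g p)%E.
    by rewrite /g patchE; case: ifP => // _; rewrite lee_fin powR_ge0.
  rewrite (_ : (fun y => _) = (fun y => \int[mu]_x g (y, x))%E).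
    exact: (measurable_leb_integral mg g0).
  apply/funext => y; apply: eq_integral => x _.
  by rewrite /g !patchE in_setX in_setT.
- apply: (measurable_funS measurableT (@subsetT _ _)).
  apply/measurable_EFinP/measurable_funM => //.
  exact: measurableT_comp.
- move=> y yB; rewrite muleC; apply: lee_wpmul2r; first by rewrite lee_fin.
  apply: (@le_trans _ _ (\int[mu]_(x in eball y (3 * rho))
      (enorm (x - y) `^ (beta - n%:R))%:E)%E).
    apply: ge0_subset_integral => //; [exact: measurable_eball..|].
    move=> x xc; rewrite /eball/=; apply: le_lt_trans (enorm_triangle c _ _) _.
    move: xc yB; rewrite /eball/= enormB [enorm (y - c)]enormB enormB.
    by lra.
  apply: le_trans (HC _ _ _) _; first by rewrite mulr_gt0.
  by rewrite lee_fin powRM// ?mulrA// ltW.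
Qed.

End riesz_kernel.

(** * Hoelder functions and pointwise bounds on the commutator kernel *)

Section kernels.
Context {R : realType} {n : nat}.
Local Notation Rn := 'rV[R]_n.
Local Notation mu := (leb R n).
Implicit Types (c x y : Rn) (rho delta L : R) (b f K : Rn -> R).

(** A point is a box with null sides; for n = 0 the product is empty and the measure is a Dirac
    mass. *)
Lemma leb_set1 x : (0 < n)%N -> mu [set x] = 0%E.
Proof.
move=> n0; rewrite (_ : [set x] = [set y | forall i, [set x ord0 i] (y ord0 i)]).
  rewrite (leb_box (A := fun i => [set x ord0 i])); last by move=> i; exact: measurable_set1.
  rewrite (eq_bigr (fun=> 0%:E)); last by move=> i _; exact: lebesgue_measure_set1.
  by rewrite prodEFin prodr_const card_ord expr0n gtn_eqF.
apply/seteqP; split => [y -> //|y /= h].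
by apply/rowP => i; exact: h.
Qed.

Lemma ae_neq x : (0 < n)%N -> {ae mu, forall y, y <> x}.
Proof.
move=> n0; exists [set x]; split; last by move=> y /= /contrapT.
  rewrite (_ : [set x] = \bigcap_(i in [set: 'I_n])
      ((fun y : Rn => y ord0 i) @^-1` [set x ord0 i])).
    apply: fin_bigcap_measurable; first exact: finite_finset.
    by move=> i _; rewrite -[X in measurable X]setTI; exact: measurable_coord.
  apply/seteqP; split => y /=; first by move=> -> i _.
  by move=> h; apply/rowP => i; exact: h.
exact: leb_set1.
Qed.

(** Estimates are proved for any admissible [L]; only in the theorem does [L] become the seminorm of
    [b]. *)
Definition hoelder_const delta b L :=
  forall x y, `|b x - b y| <= L * enorm (x - y) `^ delta.

(** For fixed x and y the condition on the constant is a closed lower bound, so it passes to the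
    infimum. *)
Lemma hoelder_Lip_norm delta b : Lip delta b -> hoelder_const delta b (Lip_norm delta b).
Proof.
move=> Lb x y; case: (Lb) => C HC.
have [t0|t0] := eqVneq (enorm (x - y) `^ delta) 0.
  by rewrite t0 mulr0; have := HC x y; rewrite t0 mulr0.
have tp : 0 < enorm (x - y) `^ delta by rewrite lt_neqAle eq_sym t0 powR_ge0.
rewrite -ler_pdivrMr//; apply: lb_le_inf; first by exists C.
by move=> M /= HM; rewrite ler_pdivrMr.
Qed.

(** As n > 0 there are two distinct points, and these force every admissible constant to be
    nonnegative. *)
Lemma Lip_norm_ge0 delta b : (0 < n)%N -> Lip delta b -> 0 <= Lip_norm delta b.
Proof.
move=> n0 [C HC]; apply: lb_le_inf; first by exists C.
move=> M /= HM; pose x : Rn := const_mx 1.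
have x0 : x <> 0.
  move=> /rowP /(_ (Ordinal n0)); rewrite !mxE => /eqP.
  by rewrite oner_eq0.
have := HM x 0; rewrite subr0 => h.
have tp : 0 < enorm x `^ delta by rewrite powR_gt0 ?enorm_gt0.
by rewrite -(pmulr_lge0 _ tp); apply: le_trans h.
Qed.

(** Shared by [b], which is Hoelder everywhere, and [K], which is so only near each point other than
    0. [M] has no sign, so |M| + 1 serves as a positive denominator. *)
Lemma hoelder_at_continuous (g : Rn -> R) x (s M d0 : R) : 0 < s -> 0 < d0 ->
  (forall y, enorm (y - x) < d0 -> `|g y - g x| <= M * enorm (y - x) `^ s) ->
  forall e, 0 < e -> exists2 d, 0 < d & forall y, enorm (y - x) < d -> `|g y - g x| < e.
Proof.
move=> s0 d00 Hg e e0.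
have M1 : 0 < `|M| + 1 by rewrite ltr_wpDl.
have a0 : 0 < e / (`|M| + 1) by rewrite divr_gt0.
exists (Num.min d0 ((e / (`|M| + 1)) `^ s^-1)).
  by rewrite lt_min d00 powR_gt0.
move=> y; rewrite lt_min => /andP[yd ye].
apply: le_lt_trans (Hg _ yd) _.
have h : enorm (y - x) `^ s <= e / (`|M| + 1).
  have sN0 : s != 0 by rewrite gt_eqF.
  have -> : e / (`|M| + 1) = ((e / (`|M| + 1)) `^ s^-1) `^ s.
    by rewrite -powRrM mulVf// powRr1// ltW.
  apply: ler_powRl; rewrite ?enorm_ge0//.
  - exact: ltW s0.
  - exact: ltW ye.
apply: (@le_lt_trans _ _ (`|M| * (e / (`|M| + 1)))).
  apply: (@le_trans _ _ (`|M| * enorm (y - x) `^ s)); last exact: ler_wpM2l.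
  by apply: ler_wpM2r; rewrite ?powR_ge0 ?ler_norm.
by rewrite mulrCA gtr_pMr// ltr_pdivrMr// mul1r ltrDl.
Qed.

Lemma measurable_hoelder delta b L : 0 < delta -> hoelder_const delta b L ->
  measurable_fun setT b.
Proof.
move=> d0 Hb; apply: measurable_fun_enorm_continuous_off0 => x _.
by apply: (@hoelder_at_continuous b x delta L 1).
Qed.

Lemma measurable_smooth_kernel alpha gamma K : 0 < gamma ->
  smooth_cond alpha gamma K -> measurable_fun setT K.
Proof.
move=> g0 [C [C0 HC]]; apply: measurable_fun_enorm_continuous_off0 => x x0.
have ex0 := enorm_gt0 x0.
apply: (@hoelder_at_continuous K x gamma (C / enorm x `^ (n%:R - alpha + gamma))
  (enorm x / 2)) => //; first by rewrite divr_gt0.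
move=> y yx.
(* With its third point at 0, the smoothness condition compares the values of [K] at x and y
   directly, provided |y - x| <= |x| / 2. *)
have := HC x y 0; rewrite !subr0 [enorm (x - y)]enormB distrC.
have h : 2 * enorm (y - x) <= enorm x by lra.
move=> /(_ h); rewrite mulrA mulrAC => h1.
by apply: le_trans h1; rewrite lerDl.
Qed.

(** The P of the overview; [commutatorE] shows that it is the kernel of the m-th commutator. *)
Definition commutator_kernel K b (m : nat) x y := K (x - y) * (b x - b y) ^+ m.

Lemma measurable_commutator_kernel2 K b m :
  measurable_fun setT K -> measurable_fun setT b ->
  measurable_fun setT (fun p : Rn * Rn => commutator_kernel K b m p.1 p.2).
Proof.
move=> mK mb; apply: measurable_funM.
  exact: (measurableT_comp mK measurable_subV).
apply: measurable_funX; apply: measurable_funB.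
  exact: (measurableT_comp mb measurable_fst).
exact: (measurableT_comp mb measurable_snd).
Qed.

Lemma measurable_commutator_kernel K b m x :
  measurable_fun setT K -> measurable_fun setT b ->
  measurable_fun setT (commutator_kernel K b m x).
Proof.
move=> mK mb; apply: measurable_funM.
  exact: (measurableT_comp mK (measurable_subVl x)).
by apply: measurable_funX; apply: measurable_funB.
Qed.

(** Each of the m factors b x - b y gains |x - y|^delta, which raises the order of the kernel from
    alpha to alphat. *)
Lemma commutator_kernel_near K b alpha delta L C m x y :
  (forall z, z <> 0 -> `|K z| <= C * enorm z `^ (alpha - n%:R)) ->
  0 <= C -> 0 <= L -> hoelder_const delta b L -> x <> y ->
  `|commutator_kernel K b m x y| <=
  C * L ^+ m * enorm (x - y) `^ (m%:R * delta + alpha - n%:R).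
Proof.
move=> HK C0 L0 Hb xy.
have xy0 : x - y <> 0 by move/eqP; rewrite subr_eq0 => /eqP.
have e0 := enorm_gt0 xy0.
rewrite normrM normrX -addrA powRDp// powRpMn.
rewrite [leRHS](_ : _ = C * enorm (x - y) `^ (alpha - n%:R) *
  (L * enorm (x - y) `^ delta) ^+ m); last by rewrite exprMn; ring.
apply: ler_pM => //; first exact: HK.
by apply: lerXn2r; rewrite ?nnegrE ?mulr_ge0 ?powR_ge0.
Qed.

(** This is |u^m - t^m| <= m |u - t| max(|u|, |t|)^(m-1), multiplied by [D] so that the exponent m -
    1 does not occur and m = 0 is no exception. *)
Lemma exprB_bound (u t L D r : R) (m : nat) : 0 <= L -> 0 <= D -> 0 <= r ->
  `|u| <= L * D -> `|t| <= L * D -> `|u - t| <= L * r ->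
  `|u ^+ m - t ^+ m| * D <= m%:R * r * (L * D) ^+ m.
Proof.
move=> L0 D0 r0 uD tD utr; elim: m => [|m IH].
  by rewrite !expr0 subrr normr0 !mul0r.
have -> : u ^+ m.+1 - t ^+ m.+1 = u * (u ^+ m - t ^+ m) + (u - t) * t ^+ m.
  by rewrite !exprS; ring.
apply: (@le_trans _ _ (`|u| * (`|u ^+ m - t ^+ m| * D) + `|u - t| * `|t| ^+ m * D)).
  by rewrite mulrA -mulrDl ler_wpM2r// -normrX -!normrM ler_normD.
apply: (@le_trans _ _ (L * D * (m%:R * r * (L * D) ^+ m) + L * r * (L * D) ^+ m * D)).
  apply: lerD; first by apply: ler_pM => //; rewrite mulr_ge0.
  apply: ler_wpM2r => //; apply: ler_pM => //; rewrite ?exprn_ge0//.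
  by apply: lerXn2r; rewrite ?nnegrE ?mulr_ge0.
by rewrite le_eqVlt; apply/orP; left; apply/eqP; rewrite exprS -natr1; ring.
Qed.

Lemma commutator_kernel_far K alpha gamma delta m :
  0 < delta -> delta < gamma -> size_cond alpha K -> smooth_cond alpha gamma K ->
  exists2 C : R, 0 < C & forall b L c x y rho,
    0 <= L -> hoelder_const delta b L -> 0 < rho ->
    enorm (x - c) < rho -> 2 * rho <= enorm (c - y) ->
    `|commutator_kernel K b m x y - commutator_kernel K b m c y| <=
    C * L ^+ m * rho `^ delta *
      enorm (c - y) `^ (- (n%:R - (m%:R * delta + alpha) + delta)).
Proof.
move=> d0 dg [C1 [C10 HC1]] [C2 [C20 HC2]].
(* [C2] accounts for the increment of [K], [C1 * m%:R] for that of the m-th power, and (2^delta)^m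
   for |x - y| <= 2 |c - y|. *)
exists ((C2 + C1 * m%:R) * (2 `^ delta) ^+ m).
  by rewrite mulr_gt0 ?exprn_gt0 ?powR_gt0// ltr_pwDl// mulr_ge0// ltW.
move=> b L c x y rho L0 Hb r0 xc yc.
have r0' := ltW r0; have d0' := ltW d0.
set d := enorm (c - y) in yc *.
have dp : 0 < d by lra.
have dp' := ltW dp.
have cy0 : c - y <> 0 by move=> h; move: dp; rewrite /d h enorm0 ltxx.
pose D := (2 * d) `^ delta.
have D0 : 0 < D by rewrite powR_gt0 ?mulr_gt0.
have dD : d `^ delta <= D.
  by apply: ler_powRl => //; lra.
have rd : rho <= d by lra.
pose u := b x - b y; pose t := b c - b y.
have uD : `|u| <= L * D.
  apply: (le_trans (Hb x y)); rewrite ler_wpM2l//.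
  apply: ler_powRl; rewrite ?enorm_ge0//.
  by have := enorm_triangle c x y; rewrite -/d; lra.
have tD : `|t| <= L * D.
  by apply: (le_trans (Hb c y)); rewrite ler_wpM2l.
have utr : `|u - t| <= L * rho `^ delta.
  rewrite (_ : u - t = b x - b c); last by rewrite /u /t; ring.
  apply: (le_trans (Hb x c)); rewrite ler_wpM2l//.
  by apply: ler_powRl; rewrite ?enorm_ge0//; exact: ltW xc.
have Kc : `|K (c - y)| <= C1 * d `^ (alpha - n%:R) by exact: HC1.
have Kxc : `|K (x - y) - K (c - y)| <=
    C2 * (rho `^ delta * d `^ (- (n%:R - alpha + delta))).
  have := HC2 c x y; rewrite -/d [enorm (c - x)]enormB distrC.
  have h : 2 * enorm (x - c) <= d by lra.
  move=> /(_ h) h1; apply: (@le_trans _ _ (C2 *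
      (enorm (x - c) `^ gamma / d `^ (n%:R - alpha + gamma)))).
    by apply: le_trans h1; rewrite lerDl.
  rewrite ler_wpM2l ?(ltW C20)//.
  (* The surplus order is traded away: rho^(gamma - delta) <= d^(gamma - delta), since rho <= d and
     delta < gamma. *)
  have -> : - (n%:R - alpha + delta) = (gamma - delta) + - (n%:R - alpha + gamma) by ring.
  rewrite powRDp// mulrA -powRN ler_wpM2r ?powR_ge0//.
  apply: (@le_trans _ _ (rho `^ gamma)).
    by apply: ler_powRl; rewrite ?enorm_ge0//; lra.
  rewrite -[in leLHS](subrKC delta gamma) (powRDp _ _ r0) ler_wpM2l ?powR_ge0//.
  by apply: ler_powRl => //; lra.
have Dm : D ^+ m = (2 `^ delta) ^+ m * d `^ (m%:R * delta).
  by rewrite powRpMn -exprMn -powRM.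
have utm : `|u ^+ m - t ^+ m| <= m%:R * rho `^ delta * (L * D) ^+ m * d `^ (- delta).
  have := exprB_bound m L0 (ltW D0) (powR_ge0 rho delta) uD tD utr.
  rewrite -ler_pdivlMr// => h; apply: le_trans h _.
  have D0' := ltW D0; rewrite ler_wpM2l//.
    by rewrite mulr_ge0 ?exprn_ge0 ?mulr_ge0 ?powR_ge0.
  by rewrite powRN lef_pV2 // posrE powR_gt0.
rewrite /commutator_kernel -/u -/t.
have -> : K (x - y) * u ^+ m - K (c - y) * t ^+ m =
    (K (x - y) - K (c - y)) * u ^+ m + K (c - y) * (u ^+ m - t ^+ m) by ring.
apply: (le_trans (ler_normD _ _)); rewrite !normrM normrX.
have E1 : d `^ (- (n%:R - (m%:R * delta + alpha) + delta)) =
    d `^ (m%:R * delta) * d `^ (- (n%:R - alpha + delta)).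
  by rewrite -powRDp//; congr (_ `^ _); ring.
have E2 : d `^ (- (n%:R - alpha + delta)) = d `^ (alpha - n%:R) * d `^ (- delta).
  by rewrite -powRDp//; congr (_ `^ _); ring.
apply: (@le_trans _ _ (C2 * (rho `^ delta * d `^ (- (n%:R - alpha + delta))) * (L * D) ^+ m
    + C1 * d `^ (alpha - n%:R) * (m%:R * rho `^ delta * (L * D) ^+ m * d `^ (- delta)))).
  apply: lerD.
    apply: ler_pM; rewrite ?exprn_ge0//.
    by apply: lerXn2r; rewrite ?nnegrE// mulr_ge0// ltW.
  by apply: ler_pM.
rewrite le_eqVlt; apply/orP; left; apply/eqP.
by rewrite E1 exprMn Dm E2; ring.
Qed.

End kernels.

(** * Hoelder's inequality against the factor of the class H *)

Section hoelder_weights.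
Context {R : realType}.

(** The endpoint of Hoelder's inequality, used directly at r = 1 and with the two functions
    exchanged at r = infinity. Positive total measure turns the norm into an essential supremum. *)
Lemma integral_mul_Lnorm_infty d (T : measurableType d)
    (mu : {measure set T -> \bar R}) (g h : T -> R) :
  (0 < mu setT)%E -> measurable_fun setT g -> measurable_fun setT h ->
  ('N[mu]_+oo[EFin \o h] < +oo)%E ->
  (\int[mu]_y (`|g y * h y|)%:E <= 'N[mu]_1[EFin \o g] * 'N[mu]_+oo[EFin \o h])%E.
Proof.
move=> muT mg mh; set S := 'N[mu]_+oo[_]%E => Soo.
have S0 : (0 <= S)%E by exact: Lnorm_ge0.
have Sfin : S \is a fin_num by rewrite ge0_fin_numE.
rewrite Lnorm1 muleC -ge0_integralZl//; last first.
  by apply/measurable_EFinP; apply: measurableT_comp.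
apply: ae_ge0_le_integral => //.
- by apply/measurable_EFinP; apply: measurableT_comp => //; exact: measurable_funM.
- by move=> y _; rewrite mule_ge0// lee_fin.
- by apply: emeasurable_funM => //; apply/measurable_EFinP; apply: measurableT_comp.
- have : {ae mu, forall y, (abse \o (EFin \o h)) y <= S}%E.
    by rewrite /S unlock muT; exact: ess_sup_ge.
  apply: filterS => y hS _; rewrite normrM EFinM muleC.
  by apply: lee_wpmul2r => //; rewrite lee_fin.
Qed.

Context {n : nat}.
Local Notation Rn := 'rV[R]_n.
Local Notation mu := (leb R n).
Implicit Types (c x y : Rn) (rho : R) (f g v : Rn -> R).

(** The weight in the integral J of the overview. For v > 0 a.e., [H_factor] is the norm, with
    exponent conjugate to r, of its product with [v] at E = n - a + delta. *)
Definition ball_decay (E : R) c rho y : R :=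
  (vol (eball c rho) `^ n%:R^-1 + enorm (c - y)) `^ (- E).

Lemma ball_decay_ge0 E c rho y : 0 <= ball_decay E c rho y.
Proof. exact: powR_ge0. Qed.

Lemma measurable_ball_decay E c rho : measurable_fun setT (ball_decay E c rho).
Proof.
apply: (measurableT_comp (measurable_powR _)); apply: measurable_funD => //.
exact: (measurableT_comp measurable_enorm (measurable_subVl c)).
Qed.

Lemma loc_integrable_measurable f : loc_integrable f -> measurable_fun setT f.
Proof.
move=> lf; rewrite -bigcup_eball.
apply/measurable_fun_bigcup => k; first exact: measurable_eball.
(* The radius is k + 1 because local integrability concerns positive radii and k may be 0. *)
have : measurable_fun (eball 0 k.+1%:R) f.
  by apply/measurable_EFinP; apply: measurable_int (lf 0 k.+1%:R _).
apply: measurable_funS; first exact: measurable_eball.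
by apply: le_eball; rewrite ler_nat.
Qed.

Lemma integral_le_H_factor (r : \bar R) (a delta : R) v c rho g :
  (1 <= r)%E -> measurable_fun setT v -> {ae mu, forall x, 0 < v x} ->
  measurable_fun setT g -> ('N[mu]_r[EFin \o g] < +oo)%E ->
  (H_factor r a delta v c rho < +oo)%E ->
  (\int[mu]_y (`|g y * v y| * ball_decay (n%:R - a + delta) c rho y)%:E
   <= 'N[mu]_r[EFin \o g] * H_factor r a delta v c rho)%E.
Proof.
move=> r1 mv v0 mg gr; set phi := ball_decay _ c rho.
have mphi : measurable_fun setT phi by exact: measurable_ball_decay.
have phi0 y : 0 <= phi y by exact: ball_decay_ge0.
pose h := v \* phi.
have mh : measurable_fun setT h by exact: measurable_funM.
have -> : (\int[mu]_y (`|g y * v y| * phi y)%:E = \int[mu]_y (`|g y * h y|)%:E)%E.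
  by apply: eq_integral => y _; rewrite /h/= mulrA [in RHS]normrM (ger0_norm (phi0 y)).
have [->|rN1] := eqVneq r 1%E.
  rewrite /H_factor eqxx => Hoo.
  exact: (integral_mul_Lnorm_infty (@leb_setT_gt0 R n) mg mh Hoo).
rewrite /H_factor (negbTE rN1).
(* Only almost everywhere, since [v] is positive only there and the power of a product is split. *)
have powE q : {ae mu, forall y, (v y `^ q / (vol (eball c rho) `^ n%:R^-1 +
    enorm (c - y)) `^ (q * (n%:R - a + delta))) = `|h y| `^ q}.
  move: v0; apply: filterS => y vy0.
  have vy := ltW vy0.
  rewrite ger0_norm ?mulr_ge0// powRM// -powRN; congr (_ * _).
  by rewrite /phi /ball_decay -powRrM mulNr [q * _]mulrC.
have mE q : measurable_fun setT (fun y => (v y `^ q / (vol (eball c rho) `^ n%:R^-1 +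
    enorm (c - y)) `^ (q * (n%:R - a + delta)))%:E : \bar R).
  apply/measurable_EFinP; apply: measurable_funM.
    exact: (measurableT_comp (measurable_powR _)).
  under eq_fun do rewrite -powRN.
  apply: (measurableT_comp (measurable_powR _)); apply: measurable_funD => //.
  exact: (measurableT_comp measurable_enorm (measurable_subVl c)).
have mhq q : measurable_fun setT (fun y => (`|h y| `^ q)%:E : \bar R).
  apply/measurable_EFinP; apply: (measurableT_comp (measurable_powR _)).
  exact: measurableT_comp.
have IE q : (\int[mu]_y (v y `^ q / (vol (eball c rho) `^ n%:R^-1 +
    enorm (c - y)) `^ (q * (n%:R - a + delta)))%:E = \int[mu]_y (`|h y| `^ q)%:E)%E.
  apply: ge0_ae_eq_integral => //.
  - by move=> y _; rewrite lee_fin divr_ge0 ?powR_ge0.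
  - by have := powE q; apply: filterS => y hy _; rewrite hy.
rewrite IE.
case: r r1 rN1 gr => [p||//]; last first.
  (* For r = infinity the conjugate exponent is 1, and the sup norm falls on [g]. *)
  rewrite hoelder_conjugatey/= => _ _ goo _.
  have -> : (\int[mu]_y (`|h y| `^ 1)%:E = \int[mu]_y (`|h y|)%:E)%E.
    by apply: eq_integral => y _; rewrite powRr1.
  rewrite invr1 poweRe1; last by apply: integral_ge0 => y _; rewrite lee_fin.
  have := integral_mul_Lnorm_infty (@leb_setT_gt0 R n) mh mg goo.
  rewrite Lnorm1 muleC; apply: le_trans.
  by under eq_integral do rewrite mulrC.
rewrite lee_fin eqe => p1 pN1 gp.
have p1' : 1 < p by rewrite lt_neqAle eq_sym pN1.
have p0 : 0 < p by rewrite (lt_trans ltr01).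
have p10 : 0 < p - 1 by rewrite subr_gt0.
have -> : fine (hoelder_conjugate p%:E) = p / (p - 1).
  by rewrite /hoelder_conjugate/= eqe gt_eqF// -EFinD inver subr_eq0 gt_eqF.
move=> _; set q := p / (p - 1).
have q0 : 0 < q by rewrite divr_gt0.
have pq : p^-1 + q^-1 = 1 by rewrite /q; field; rewrite !gt_eqF.
have := hoelder mu mg mh p0 q0 pq.
rewrite Lnorm1 => H; apply: le_trans H _.
suff <- : ('N[mu]_q%:E[EFin \o h] = (\int[mu]_y (`|h y| `^ q)%:E) `^ q^-1)%E by [].
rewrite unlock; congr (_ `^ _)%E.
Qed.

Lemma integral_ball_decay_le (r : \bar R) (a delta : R) v c rho f :
  (1 <= r)%E -> measurable_fun setT v -> {ae mu, forall x, 0 < v x} ->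
  measurable_fun setT f -> (fun x => f x / v x) \in Lfun mu r ->
  (H_factor r a delta v c rho < +oo)%E ->
  (\int[mu]_y (`|f y| * ball_decay (n%:R - a + delta) c rho y)%:E
   <= 'N[mu]_r[EFin \o (fun x => f x / v x)%R] * H_factor r a delta v c rho)%E.
Proof.
move=> r1 mv v0 mf /andP[]; rewrite !inE => mg /= gr Hoo.
apply: le_trans (integral_le_H_factor r1 mv v0 mg gr Hoo).
have mphi := measurable_ball_decay (n%:R - a + delta) c rho.
apply: ae_ge0_le_integral => //.
- by move=> y _; rewrite lee_fin mulr_ge0// ball_decay_ge0.
- by apply/measurable_EFinP; apply: measurable_funM => //; apply: measurableT_comp.
- by move=> y _; rewrite lee_fin mulr_ge0// ball_decay_ge0.
- apply/measurable_EFinP; apply: measurable_funM => //; apply: measurableT_comp => //.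
  exact: measurable_funM.
- by move: v0; apply: filterS => y vy _; rewrite divfK// gt_eqF.
Qed.

End hoelder_weights.

(** * The corrected kernel and its double integral over a ball *)

Section corrected_kernel.
Context {R : realType} {n : nat}.
Local Notation Rn := 'rV[R]_n.
Local Notation mu := (leb R n).
Implicit Types (c x y : Rn) (rho L : R) (b f K : Rn -> R) (m : nat).

Definition far_kernel K b m c rho y :=
  commutator_kernel K b m c y * \1_(~` eball c (2 * rho)) y.

(** The Q of the overview. *)
Definition corrected_kernel K b m c rho x y :=
  commutator_kernel K b m x y - far_kernel K b m c rho y.

Lemma measurable_far_kernel K b m c rho :
  measurable_fun setT K -> measurable_fun setT b ->
  measurable_fun setT (far_kernel K b m c rho).
Proof.
move=> mK mb; apply: measurable_funM; first exact: measurable_commutator_kernel.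
by apply: measurable_indic; apply: measurableC; exact: measurable_eball.
Qed.

Lemma measurable_corrected_kernel2 K b m c rho :
  measurable_fun setT K -> measurable_fun setT b ->
  measurable_fun setT (fun p : Rn * Rn => corrected_kernel K b m c rho p.1 p.2).
Proof.
move=> mK mb; apply: measurable_funB; first exact: measurable_commutator_kernel2.
apply: (measurableT_comp (f := far_kernel K b m c rho)); last exact: measurable_snd.
exact: measurable_far_kernel.
Qed.

Lemma measurable_corrected_kernel K b m c rho x :
  measurable_fun setT K -> measurable_fun setT b ->
  measurable_fun setT (corrected_kernel K b m c rho x).
Proof.
move=> mK mb; apply: measurable_funB; first exact: measurable_commutator_kernel.
exact: measurable_far_kernel.
Qed.

Lemma vol_root_le c rho : (0 < n)%N -> 0 <= rho ->
  vol (eball c rho) `^ n%:R^-1 <= 2 * rho.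
Proof.
move=> n0 r0; have n0' : n%:R != 0 :> R by rewrite pnatr_eq0 -lt0n.
have -> : 2 * rho = ((2 * rho) ^+ n) `^ n%:R^-1.
  by rewrite -powR_mulrn ?mulr_ge0// -powRrM divff// powRr1// mulr_ge0.
apply: ler_powRl; rewrite ?invr_ge0//; last exact: vol_le.
by rewrite fine_ge0.
Qed.

(** Since |B|^(1/n) <= 2 rho, the base of the decay is at most 2 |c - y| outside 2B; inside 2B, the
    case of the next lemma, it is at most 4 rho. *)
Lemma ball_decay_ge_far (E : R) c rho y : (0 < n)%N -> 0 <= E -> 0 < rho ->
  2 * rho <= enorm (c - y) ->
  enorm (c - y) `^ (- E) <= 2 `^ E * ball_decay E c rho y.
Proof.
move=> n0 E0 r0 h; have d0 : 0 < enorm (c - y) by lra.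
have -> : enorm (c - y) `^ (- E) = 2 `^ E * (2 * enorm (c - y)) `^ (- E).
  rewrite powRM ?(ltW d0)// mulrA -[X in X * _](_ : 1 = _) ?mul1r//.
  by rewrite -powRDp// subrr powRr0.
rewrite ler_wpM2l ?powR_ge0//; apply: ler_powRN => //.
  by rewrite ltr_wpDl// powR_ge0.
by have := vol_root_le c n0 (ltW r0); lra.
Qed.

Lemma ball_decay_ge_near (E : R) c rho y : (0 < n)%N -> 0 <= E -> 0 < rho ->
  eball c (2 * rho) y -> 1 <= (4 * rho) `^ E * ball_decay E c rho y.
Proof.
move=> n0 E0 r0; rewrite /eball/= enormB => h.
have r40 : 0 < 4 * rho by rewrite mulr_gt0.
apply: (@le_trans _ _ ((4 * rho) `^ E * (4 * rho) `^ (- E))).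
  by rewrite -powRDp// subrr powRr0.
rewrite ler_wpM2l ?powR_ge0//; apply: ler_powRN => //.
  by rewrite ltr_pwDl ?enorm_ge0// powR_gt0// vol_gt0.
by have := vol_root_le c n0 (ltW r0); lra.
Qed.

Lemma integral_near_le_decay (E : R) c rho f : (0 < n)%N -> 0 <= E -> 0 < rho ->
  measurable_fun setT f ->
  (\int[mu]_(y in eball c (2 * rho)) `|f y|%:E <=
   ((4 * rho) `^ E)%:E * \int[mu]_y (`|f y| * ball_decay E c rho y)%:E)%E.
Proof.
move=> n0 E0 r0 mf.
have mfa : measurable_fun setT (fun y => `|f y|) by exact: measurableT_comp.
have mJ : measurable_fun setT (fun y => (`|f y| * ball_decay E c rho y)%:E : \bar R).
  apply/measurable_EFinP; apply: measurable_funM => //.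
  exact: measurable_ball_decay.
rewrite -ge0_integralZl//; last 2 first.
- by move=> y _; rewrite lee_fin mulr_ge0// ?ball_decay_ge0.
- by rewrite lee_fin powR_ge0.
apply: (@le_trans _ _ (\int[mu]_(y in eball c (2 * rho))
    (((4 * rho) `^ E)%:E * (`|f y| * ball_decay E c rho y)%:E))%E); last first.
  apply: ge0_subset_integral => //; first exact: measurable_eball.
    exact: emeasurable_funM.
  by move=> y _; rewrite lee_fin !mulr_ge0 ?powR_ge0.
apply: ge0_le_integral => //; first exact: measurable_eball.
- by apply: (measurable_funS measurableT (@subsetT _ _)); apply/measurable_EFinP.
- by apply: (measurable_funS measurableT (@subsetT _ _)); exact: emeasurable_funM.
- move=> y yB; rewrite -EFinM lee_fin mulrCA ler_peMr//.
  exact: ball_decay_ge_near.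
Qed.

Lemma corrected_kernel_ball_estimate K alpha gamma delta m :
  0 < alpha -> 0 < delta -> delta < gamma -> m%:R * delta + alpha < n%:R ->
  size_cond alpha K -> smooth_cond alpha gamma K ->
  exists2 C : R, 0 < C & forall b L f c rho,
    0 <= L -> hoelder_const delta b L -> measurable_fun setT f -> 0 < rho ->
    (\int[mu]_(x in eball c rho) \int[mu]_y
        `|corrected_kernel K b m c rho x y * f y|%:E <=
     (C * L ^+ m * rho `^ (n%:R + delta))%:E *
     \int[mu]_y (`|f y| * ball_decay (n%:R - (m%:R * delta + alpha) + delta)
                                     c rho y)%:E)%E.
Proof.
move=> a0 d0 dg an Ks Ksm.
set a := m%:R * delta + alpha in an *; set E := n%:R - a + delta.
have a_gt0 : 0 < a by rewrite ltr_wpDl// mulr_ge0// ltW.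
have E0 : 0 < E by rewrite addr_gt0// subr_gt0.
have n0 : (0 < n)%N by rewrite -(ltr_nat R) (lt_trans a_gt0 an).
have g0 : 0 < gamma by exact: lt_trans dg.
have mK := measurable_smooth_kernel g0 Ksm.
have [C1 [C10 HC1]] := Ks.
have [CF CF0 HCF] := commutator_kernel_far m d0 dg Ks Ksm.
have [CR CR0 HCR] := riesz_potential_near a_gt0 an.
(* The first summand is the near part: size of [K], Riesz potential, decay inside 2B. The second is
   the far part: kernel bound, decay outside 2B, volume of B. *)
exists (C1 * CR * 4 `^ E + CF * 2 `^ E * 2 ^+ n).
  by rewrite addr_gt0// !mulr_gt0 ?powR_gt0 ?exprn_gt0.
move=> b L f c rho L0 Hb mf r0.
have mb := measurable_hoelder d0 Hb.
have mfa : measurable_fun setT (fun y => `|f y|) by exact: measurableT_comp.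
set J := (X in (_ <= _ * X)%E).
have J0 : (0 <= J)%E.
  by apply: integral_ge0 => y _; rewrite lee_fin mulr_ge0// ?ball_decay_ge0.
have mJ : measurable_fun setT (fun y => (`|f y| * ball_decay E c rho y)%:E : \bar R).
  apply/measurable_EFinP; apply: measurable_funM => //.
  exact: measurable_ball_decay.
pose A1 := C1 * L ^+ m; pose A2 := CF * 2 `^ E * L ^+ m * rho `^ delta.
have A10 : 0 <= A1 by rewrite mulr_ge0 ?exprn_ge0// ltW.
have A20 : 0 <= A2 by rewrite !mulr_ge0 ?exprn_ge0 ?powR_ge0// ltW.
pose N x := (\int[mu]_(y in eball c (2 * rho))
  (enorm (x - y) `^ (a - n%:R) * `|f y|)%:E)%E.
have N0 x : (0 <= N x)%E.
  by apply: integral_ge0 => y _; rewrite lee_fin mulr_ge0// powR_ge0.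
have mN : measurable_fun setT N by exact: measurable_riesz_potential.
have mQf x : measurable_fun setT
    (fun y => `|corrected_kernel K b m c rho x y * f y|%:E : \bar R).
  apply/measurable_EFinP; apply: measurableT_comp => //.
  by apply: measurable_funM => //; exact: measurable_corrected_kernel.
have step x : eball c rho x ->
    (\int[mu]_y `|corrected_kernel K b m c rho x y * f y|%:E <= A1%:E * N x + A2%:E * J)%E.
  move=> xB.
  pose g := ((fun y => (enorm (x - y) `^ (a - n%:R) * `|f y|)%:E) \_ (eball c (2 * rho)) :
    Rn -> \bar R).
  have g_ge0 y : (0 <= g y)%E.
    by rewrite /g patchE; case: ifP => // _; rewrite lee_fin mulr_ge0// powR_ge0.
  have mg : measurable_fun setT g.
    apply: (proj1 (measurable_restrictT _ (measurable_eball _ _))).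
    apply: (measurable_funS measurableT (@subsetT _ _)).
    apply/measurable_EFinP; apply: measurable_funM => //.
    apply: (measurableT_comp (measurable_powR _)).
    exact: (measurableT_comp measurable_enorm (measurable_subVl x)).
  have NE : N x = (\int[mu]_y g y)%E by rewrite /N integral_mkcond.
  rewrite NE -ge0_integralZl// -ge0_integralZl//; last first.
    by move=> y _; rewrite lee_fin mulr_ge0// ?ball_decay_ge0.
  rewrite -ge0_integralD//; last 4 first.
  - by move=> y _; rewrite mule_ge0.
  - exact: emeasurable_funM.
  - by move=> y _; rewrite mule_ge0 ?lee_fin // mulr_ge0 // ball_decay_ge0.
  - exact: emeasurable_funM.
  apply: ae_ge0_le_integral => //.
  - move=> y _; apply: adde_ge0; first by rewrite mule_ge0.
    by rewrite mule_ge0 ?lee_fin // mulr_ge0 // ball_decay_ge0.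
  - by apply: emeasurable_funD; exact: emeasurable_funM.
  (* The diagonal, where the size condition is silent, is a null set. *)
  have := ae_neq x n0; apply: filterS => y yx _.
  have xy : x <> y by move=> h; apply: yx.
  rewrite /corrected_kernel /far_kernel normrM indicE.
  have [yB|yB] := pselect (eball c (2 * rho) y).
    rewrite memNset; last by move=> /=; exact.
    rewrite mulr0 subr0 /g patchE mem_set//= -!EFinM -EFinD lee_fin.
    rewrite -[leLHS]addr0; apply: lerD; last by rewrite mulr_ge0 // mulr_ge0 // ball_decay_ge0.
    rewrite mulrA ler_wpM2r//.
    exact: commutator_kernel_near HC1 (ltW C10) L0 Hb xy.
  rewrite mem_set//= mulr1 /g patchE memNset//= mule0 add0e.
  rewrite -EFinM lee_fin [leRHS]mulrCA mulrC ler_wpM2l//.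
  have yc : 2 * rho <= enorm (c - y).
    by rewrite leNgt; apply/negP; rewrite enormB => ?; apply: yB.
  apply: (le_trans (HCF b L c x y rho L0 Hb r0 xB yc)).
  have := ball_decay_ge_far n0 (ltW E0) r0 yc.
  move=> /(ler_wpM2l (_ : 0 <= CF * L ^+ m * rho `^ delta)) h.
  apply: le_trans (h _) _; first by rewrite !mulr_ge0 ?exprn_ge0 ?powR_ge0// ltW.
  by rewrite le_eqVlt; apply/orP; left; apply/eqP; rewrite /A2; ring.
apply: (@le_trans _ _ (\int[mu]_(x in eball c rho) (A1%:E * N x + A2%:E * J))%E).
  apply: ge0_le_integral; first exact: measurable_eball.
  - by move=> x _; apply: integral_ge0 => y _; rewrite lee_fin.
  - apply: (measurable_funS measurableT (@subsetT _ _)).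
    pose q (p : Rn * Rn) : \bar R := `|corrected_kernel K b m c rho p.1 p.2 * f p.2|%:E.
    have mq : measurable_fun setT q.
      apply/measurable_EFinP; apply: measurableT_comp => //.
      apply: measurable_funM; first exact: measurable_corrected_kernel2.
      exact: (measurableT_comp mf measurable_snd).
    have q0 p : (0 <= q p)%E by rewrite lee_fin.
    exact: (measurable_leb_integral mq q0).
  - apply: (measurable_funS measurableT (@subsetT _ _)).
    by apply: emeasurable_funD => //; exact: emeasurable_funM.
  - exact: step.
have mNB : measurable_fun (eball c rho) N.
  exact: (measurable_funS measurableT (@subsetT _ _)).
rewrite ge0_integralD//; last 4 first.
- exact: measurable_eball.
- by move=> x _; rewrite mule_ge0.
- exact: emeasurable_funM.
- by move=> x _; rewrite mule_ge0.
rewrite ge0_integralZl//; last exact: measurable_eball.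
rewrite integral_cst; last exact: measurable_eball.
have r0' := ltW r0.
(* The near part carries rho^alphat from the Riesz potential and rho^E from the decay, the far part
   rho^n from the volume and rho^delta from the kernel: both products are rho^(n + delta). *)
have rE : rho `^ (n%:R + delta) = rho `^ a * rho `^ E.
  by rewrite -powRDp//; congr (_ `^ _); rewrite /E; ring.
have rE2 : rho `^ (n%:R + delta) = rho ^+ n * rho `^ delta.
  by rewrite powRDp// powR_mulrn.
apply: (@le_trans _ _ ((A1 * (CR * rho `^ a) * (4 * rho) `^ E)%:E * J +
    (A2 * (2 * rho) ^+ n)%:E * J)%E).
  apply: leeD.
    have -> : (A1 * (CR * rho `^ a) * (4 * rho) `^ E)%:E =
        (A1%:E * ((CR * rho `^ a)%:E * ((4 * rho) `^ E)%:E))%E.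
      by rewrite -!EFinM [in RHS]mulrA.
    rewrite -!muleA; apply: lee_wpmul2l; first by rewrite lee_fin.
    apply: (le_trans (HCR f c rho mf r0)); apply: lee_wpmul2l.
      by rewrite lee_fin mulr_ge0 ?powR_ge0// ltW.
    exact: integral_near_le_decay n0 (ltW E0) r0 mf.
  have -> : (A2 * (2 * rho) ^+ n)%:E = (A2%:E * ((2 * rho) ^+ n)%:E)%E by [].
  rewrite muleAC; apply: lee_wpmul2r => //; apply: lee_wpmul2l.
    by rewrite lee_fin.
  exact: leb_eball_le.
rewrite -ge0_muleDl ?lee_fin; last 2 first.
- by rewrite mulr_ge0 ?powR_ge0// mulr_ge0// mulr_ge0 ?powR_ge0// ltW.
- by rewrite mulr_ge0// exprn_ge0// mulr_ge0.
apply: lee_wpmul2r => //; rewrite -EFinD lee_fin.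
rewrite le_eqVlt; apply/orP; left; apply/eqP.
rewrite (mulrDl (C1 * CR * 4 `^ E)) (mulrDl (C1 * CR * 4 `^ E * _)).
congr (_ + _).
  by rewrite rE /A1 powRM//; ring.
by rewrite rE2 /A2 exprMn; ring.
Qed.

End corrected_kernel.

(** * Mean oscillation on a ball *)

Section mean_oscillation.
Context {R : realType} {n : nat}.
Local Notation Rn := 'rV[R]_n.
Local Notation mu := (leb R n).
Implicit Types (c x y : Rn) (rho : R) (f : Rn -> R).

Lemma integrable_cst_eball c rho (t : R) :
  mu.-integrable (eball c rho) (EFin \o cst t).
Proof.
apply: measurable_bounded_integrable => //; first exact: measurable_eball.
  exact: leb_eball_lty.
exists `|t|; split; first exact: num_real.
by move=> M tM x _; exact: ltW.
Qed.

(** The distance from the mean to [a], times the volume, is at most the integral of |f - a|; hence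
    any constant may replace the mean at the cost of a factor 2. *)
Lemma integral_mean_oscillation_le c rho f (a : R) : 0 < rho ->
  mu.-integrable (eball c rho) (EFin \o f) ->
  (\int[mu]_(x in eball c rho) `|f x - mean (eball c rho) f|%:E <=
   2%:E * \int[mu]_(x in eball c rho) `|f x - a|%:E)%E.
Proof.
move=> r0 intf; set B := eball c rho in intf *.
have mB : measurable B by exact: measurable_eball.
have V0 : 0 < vol B by exact: vol_gt0.
have intc t : mu.-integrable B (EFin \o cst t).
  exact: integrable_cst_eball.
have intfa t : mu.-integrable B (EFin \o (fun x => f x - t)).
  exact: (integrableB mB intf (intc t)).
have intfaa t : mu.-integrable B (EFin \o (fun x => `|f x - t|)).
  exact: integrable_norm (intfa t).
pose I := \int[mu]_(x in B) `|f x - a|.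
have IE : (\int[mu]_(x in B) `|f x - a|%:E = I%:E)%E.
  by rewrite /I /Rintegral fineK//; exact: integrable_fin_num (intfaa a).
have meanE : mean B f - a = (vol B)^-1 * \int[mu]_(x in B) (f x - a).
  have Ia : \int[mu]_(x in B) a = a * vol B.
    by have := Rintegral_cst mu mB a.
  rewrite (RintegralB mB intf (intc a)) Ia mulrBr mulrCA.
  by rewrite mulVf ?mulr1// gt_eqF.
have meanI : `|mean B f - a| * vol B <= I.
  rewrite meanE normrM gtr0_norm ?invr_gt0// mulrAC mulVf ?gt_eqF// mul1r.
  exact: le_normr_Rintegral.
apply: (@le_trans _ _ (\int[mu]_(x in B) (`|f x - a|%:E + `|mean B f - a|%:E))%E).
  have mf t : measurable_fun B (fun x => `|f x - t|%:E : \bar R).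
    exact: measurable_int (intfaa t).
  apply: ge0_le_integral => //.
  - by apply: emeasurable_funD.
  - move=> x _; rewrite -EFinD lee_fin.
    have -> : f x - mean B f = (f x - a) - (mean B f - a) by ring.
    exact: ler_normB.
rewrite ge0_integralD//; last exact: measurable_int (intfaa a).
rewrite integral_cst// IE -volE -EFinM -EFinM -EFinD lee_fin.
by rewrite [2 * I](_ : _ = I + I) ?lerD2l//; ring.
Qed.

End mean_oscillation.

(** * The iterated commutator as a single integral *)

Section commutator_formula.
Context {R : realType} {n : nat}.
Local Notation Rn := 'rV[R]_n.
Local Notation mu := (leb R n).
Implicit Types (c x y : Rn) (b f K : Rn -> R) (m : nat).

(** The inductive step uses the statement at [f] and at [b \* f], so the hypothesis concerns every
    b^j f with j <= m. Absolute convergence is carried along to justify subtracting integrals. *)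
Lemma commutatorE K b m f x :
  (forall j, (j <= m)%N ->
     mu.-integrable setT (fun y => (K (x - y) * (b y ^+ j * f y))%:E)) ->
  mu.-integrable setT (fun y => (commutator_kernel K b m x y * f y)%:E) /\
  commutator K b m f x = \int[mu]_y (commutator_kernel K b m x y * f y).
Proof.
elim: m f => [|m IH] f H.
  have E y : commutator_kernel K b 0 x y * f y = K (x - y) * f y.
    by rewrite /commutator_kernel expr0 mulr1.
  split.
    have := H 0%N isT; apply: eq_integrable => //.
    by move=> y _; rewrite E expr0 mul1r.
  by apply: eq_Rintegral => y _; rewrite E.
have [I1 E1] := IH f (fun j jm => H j (leqW jm)).
have [|I2 E2] := IH (b \* f).
  move=> j jm; have := H j.+1 jm; apply: eq_integrable => //.
  by move=> y _; congr EFin; rewrite exprSr /=; ring.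
have Pm y : commutator_kernel K b m.+1 x y * f y =
    b x * (commutator_kernel K b m x y * f y) - commutator_kernel K b m x y * (b y * f y).
  by rewrite /commutator_kernel exprS; ring.
have I3 : mu.-integrable setT (EFin \o (fun y => b x * (commutator_kernel K b m x y * f y))).
  exact: (@integrableZl _ _ _ mu setT measurableT (b x) _ I1).
split.
  have := integrableB measurableT I3 I2; apply: eq_integrable => //.
  by move=> y _; rewrite /= Pm.
rewrite {1}/commutator iterS -/(commutator K b m) /bracket E1 E2.
rewrite -RintegralZl// -RintegralB//.
by apply: eq_Rintegral => y _; rewrite Pm.
Qed.

Lemma commutator_domP K b m f : commutator_dom K b m f ->
  forall j, (j <= m)%N -> frac_op_dom K (fun y => b y ^+ j * f y).
Proof.
elim: m f => [|m IH] f.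
  move=> H [|//] _; suff -> : (fun y => b y ^+ 0 * f y) = f by [].
  by apply/funext => y; rewrite expr0 mul1r.
rewrite /commutator_dom iterS -/(commutator_dom K b m) => -[H1 H2] [|j] jm.
  exact: (IH f H1 0%N).
suff -> : (fun y => b y ^+ j.+1 * f y) = (fun y => b y ^+ j * (b \* f) y).
  exact: (IH _ H2).
by apply/funext => y; rewrite exprSr /= mulrA.
Qed.

Lemma measurable_commutator K b m f :
  measurable_fun setT K -> measurable_fun setT b -> measurable_fun setT f ->
  measurable_fun setT (commutator K b m f).
Proof.
move=> mK mb; elim: m f => [|m IH] f mf.
  apply: (measurable_leb_Rintegral (f := fun p : Rn * Rn => K (p.1 - p.2) * f p.2)).
  apply: measurable_funM; first exact: (measurableT_comp mK measurable_subV).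
  exact: (measurableT_comp mf measurable_snd).
rewrite /commutator iterS; apply: measurable_funB.
  by apply: measurable_funM => //; exact: IH.
by apply: IH; exact: measurable_funM.
Qed.

End commutator_formula.

(** * Functions given by the commutator kernel up to a constant *)

Section kernel_versions.
Context {R : realType} {n : nat}.
Local Notation Rn := 'rV[R]_n.
Local Notation mu := (leb R n).
Implicit Types (c x y : Rn) (rho L : R) (b f g K Phi : Rn -> R) (m : nat).

Lemma ae_lty_integral (B : set Rn) (h : Rn -> \bar R) : measurable B ->
  measurable_fun B h -> (forall x, 0 <= h x)%E ->
  (\int[mu]_(x in B) h x < +oo)%E -> {ae mu, forall x, B x -> (h x < +oo)%E}.
Proof.
move=> mB mh h0 hoo.
have : mu.-integrable B h.
  by apply/integrableP; split => //; under eq_integral do rewrite gee0_abs//.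
move=> /(integrable_ae mB); apply: filterS => x Hx Bx.
by have := Hx Bx; rewrite ge0_fin_numE.
Qed.

(** As [g] does not depend on x, two choices of it differ formally by a constant; leaving [g] free
    covers both the commutator itself and its renormalisation. *)
Definition kernel_version K b m f g Phi :=
  {ae mu, forall x,
     mu.-integrable setT (fun y => ((commutator_kernel K b m x y - g y) * f y)%:E) /\
     Phi x = \int[mu]_y ((commutator_kernel K b m x y - g y) * f y)}.

Lemma ae_integrable_corrected_kernel K b m f c rho :
  measurable_fun setT K -> measurable_fun setT b -> measurable_fun setT f ->
  (\int[mu]_(x in eball c rho) \int[mu]_y
     `|corrected_kernel K b m c rho x y * f y|%:E < +oo)%E ->
  {ae mu, forall x, eball c rho x ->
     mu.-integrable setT (fun y => (corrected_kernel K b m c rho x y * f y)%:E)}.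
Proof.
move=> mK mb mf.
pose q (p : Rn * Rn) : \bar R := `|corrected_kernel K b m c rho p.1 p.2 * f p.2|%:E.
have mq : measurable_fun setT q.
  apply/measurable_EFinP; apply: measurableT_comp => //.
  apply: measurable_funM; first exact: measurable_corrected_kernel2.
  exact: (measurableT_comp mf measurable_snd).
have q0 p : (0 <= q p)%E by rewrite lee_fin.
have mq1 := measurable_leb_integral mq q0.
move=> /(ae_lty_integral (measurable_eball _ _)
  (measurable_funS measurableT (@subsetT _ _) mq1)) H.
have := H (fun x => integral_ge0 _ (fun y _ => q0 (x, y))).
apply: filterS => x Hx /Hx xoo; apply/integrableP; split.
  apply/measurable_EFinP; apply: measurable_funM => //.
  exact: measurable_corrected_kernel.
by under eq_integral do rewrite abse_EFin.
Qed.

(* On the ball, [Phi] differs by an additive constant from the integral against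
   the corrected kernel, which converges absolutely at almost every point. *)
Lemma kernel_version_oscillation K b m f g Phi c rho :
  measurable_fun setT K -> measurable_fun setT b -> measurable_fun setT f ->
  measurable_fun setT Phi -> kernel_version K b m f g Phi -> 0 < rho ->
  (\int[mu]_(x in eball c rho) \int[mu]_y
     `|corrected_kernel K b m c rho x y * f y|%:E < +oo)%E ->
  mu.-integrable (eball c rho) (EFin \o Phi) /\
  (\int[mu]_(x in eball c rho) `|Phi x - mean (eball c rho) Phi|%:E <=
   2%:E * \int[mu]_(x in eball c rho) \int[mu]_y
     `|corrected_kernel K b m c rho x y * f y|%:E)%E.
Proof.
move=> mK mb mf mPhi HPhi r0; set S := (X in (X < _)%E) => Soo.
have aeQ := ae_integrable_corrected_kernel mK mb mf Soo.
pose Q x y := corrected_kernel K b m c rho x y * f y.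
pose k y := (far_kernel K b m c rho y - g y) * f y.
have kE x y : (commutator_kernel K b m x y - g y) * f y = Q x y + k y.
  by rewrite /Q /corrected_kernel /k; ring.
(* One point where both integrals converge is enough: there the integrands differ by [k], which does
   not depend on x, so [k] is integrable and its integral is the constant sought. *)
have [x0 x0B [[H1 H2] H3]] : exists2 x0, eball c rho x0 &
    (mu.-integrable setT (fun y => ((commutator_kernel K b m x0 y - g y) * f y)%:E) /\
     Phi x0 = \int[mu]_y ((commutator_kernel K b m x0 y - g y) * f y)) /\
    mu.-integrable setT (EFin \o Q x0).
  apply: (ae_eballP r0); apply: filterS2 HPhi aeQ => x h1 h2 xB.
  by split => //; exact: h2.
have ik : mu.-integrable setT (EFin \o k).
  have := integrableB measurableT H1 H3; apply: eq_integrable => //.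
  by move=> y _; rewrite /= -EFinB kE; congr EFin; ring.
pose a := \int[mu]_y k y.
have PhiE : {ae mu, forall x, eball c rho x ->
    `|Phi x - a|%:E <= \int[mu]_y `|Q x y|%:E}%E.
  apply: filterS2 HPhi aeQ => x [h1 h2] /[apply] iQ.
  have {}iQ : mu.-integrable setT (EFin \o Q x) by exact: iQ.
  rewrite h2 (_ : \int[mu]_y _ - a = \int[mu]_y Q x y).
    rewrite EFin_normr_Rintegral//; apply: le_trans (le_abse_integral _ _ _) _ => //.
    exact: measurable_int iQ.
  have -> : \int[mu]_y ((commutator_kernel K b m x y - g y) * f y) =
      \int[mu]_y (Q x y + k y) by apply: eq_Rintegral => y _; rewrite kE.
  by rewrite RintegralD// addrK.
have mB := @measurable_eball R n c rho.
have mPa t : measurable_fun (eball c rho) (EFin \o (fun x => Phi x - t)).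
  apply: (measurable_funS measurableT (@subsetT _ _)).
  by apply/measurable_EFinP; exact: measurable_funB.
have le1 : (\int[mu]_(x in eball c rho) `|Phi x - a|%:E <= S)%E.
  apply: ae_ge0_le_integral => //.
  - apply/measurable_EFinP; apply: measurableT_comp => //.
    by apply/measurable_EFinP; exact: mPa.
  - by move=> x _; apply: integral_ge0.
  - apply: (measurable_funS measurableT (@subsetT _ _)).
    apply: (measurable_leb_integral
      (f := fun p : Rn * Rn => `|corrected_kernel K b m c rho p.1 p.2 * f p.2|%:E)) => //.
    apply/measurable_EFinP; apply: measurableT_comp => //.
    apply: measurable_funM; first exact: measurable_corrected_kernel2.
    exact: (measurableT_comp mf measurable_snd).
have iPa : mu.-integrable (eball c rho) (EFin \o (fun x => Phi x - a)).
  by apply/integrableP; split => //; exact: le_lt_trans Soo.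
have iPhi : mu.-integrable (eball c rho) (EFin \o Phi).
  have ic : mu.-integrable (eball c rho) (EFin \o cst a).
    exact: integrable_cst_eball.
  have := integrableD mB iPa ic; apply: eq_integrable => //.
  by move=> x _; rewrite /= -EFinD subrK.
split => //.
apply: (le_trans (integral_mean_oscillation_le a r0 iPhi)).
exact: lee_wpmul2l.
Qed.

Lemma kernel_version_commutator K b m f : commutator_dom K b m f ->
  kernel_version K b m f (cst 0) (commutator K b m f).
Proof.
move=> /commutator_domP H.
have : {ae mu, forall x, forall j, (j <= m)%N ->
    mu.-integrable setT (fun y => (K (x - y) * (b y ^+ j * f y))%:E)}.
  apply: ae_foralln => j; have [jm|jm] := leqP j m.
    by have := H j jm; apply: filterS => x Hx _.
  by apply: nearW => x.
apply: filterS => x /commutatorE[I E]; split.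
  by apply: eq_integrable I => // y _; rewrite subr0.
by rewrite E; apply: eq_Rintegral => y _; rewrite subr0.
Qed.

End kernel_versions.

(** * Existence of a version, as a limit of truncations *)

Section truncations.
Context {R : realType} {n : nat}.
Local Notation Rn := 'rV[R]_n.
Local Notation mu := (leb R n).
Implicit Types (c x y : Rn) (rho L : R) (b f g h K : Rn -> R) (m : nat).

Lemma integrable_mul_bounded_support h f c rho (M : R) :
  measurable_fun setT h -> measurable_fun setT f -> 0 <= M ->
  (\int[mu]_(y in eball c rho) `|f y|%:E < +oo)%E ->
  (forall y, `|h y| <= M * \1_(eball c rho) y) ->
  mu.-integrable setT (fun y => (h y * f y)%:E).
Proof.
move=> mh mf M0 foo hM.
have mfa : measurable_fun (eball c rho) (fun y => `|f y|%:E : \bar R).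
  apply: (measurable_funS measurableT (@subsetT _ _)).
  by apply/measurable_EFinP; exact: measurableT_comp.
apply/integrableP; split; first by apply/measurable_EFinP; exact: measurable_funM.
apply: (@le_lt_trans _ _ (M%:E * \int[mu]_(y in eball c rho) `|f y|%:E)%E); last first.
  by rewrite lte_mul_pinfty.
rewrite -ge0_integralZl//; last exact: measurable_eball.
rewrite [leRHS]integral_mkcond; apply: ge0_le_integral => //.
- apply: measurableT_comp => //.
  by apply/measurable_EFinP; exact: measurable_funM.
- apply: (proj1 (measurable_restrictT _ (measurable_eball _ _))).
  exact: emeasurable_funM.
- move=> y _; rewrite patchE abse_EFin normrM; have := hM y; rewrite indicE.
  case: (y \in eball c rho) => /=; first by rewrite mulr1 => h1; rewrite -EFinM lee_fin ler_wpM2r.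
  by rewrite mulr0 normr_le0 => /eqP ->; rewrite normr0 mul0r.
Qed.

(** Off 2B the distance |c - y| is at least 2 rho and the exponent alphat - n is negative, so the
    size bound is largest at distance 2 rho. *)
Lemma far_kernel_bounded K b alpha delta L C m c rho y :
  (forall z, z <> 0 -> `|K z| <= C * enorm z `^ (alpha - n%:R)) ->
  0 <= C -> 0 <= L -> hoelder_const delta b L ->
  m%:R * delta + alpha < n%:R -> 0 < rho ->
  `|far_kernel K b m c rho y| <=
  C * L ^+ m * (2 * rho) `^ (m%:R * delta + alpha - n%:R).
Proof.
move=> HK C0 L0 Hb an r0.
rewrite /far_kernel normrM indicE.
have [yB|yB] := pselect (eball c (2 * rho) y).
  rewrite memNset; last by move=> /=; exact.
  by rewrite normr0 mulr0 !mulr_ge0 ?exprn_ge0 ?powR_ge0.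
rewrite mem_set//= normr1 mulr1.
have yc : 2 * rho <= enorm (c - y).
  by rewrite leNgt; apply/negP; rewrite enormB => ?; apply: yB.
have cy : c <> y by move=> cy; move: yc; rewrite cy subrr enorm0; lra.
apply: (le_trans (commutator_kernel_near m HK C0 L0 Hb cy)).
rewrite ler_wpM2l ?mulr_ge0 ?exprn_ge0//.
have -> : m%:R * delta + alpha - n%:R = - (n%:R - (m%:R * delta + alpha)).
  by rewrite opprB.
apply: ler_powRN => //; first by rewrite subr_ge0 ltW.
by rewrite mulr_gt0.
Qed.

(** Convergence at x is known for a correction on a ball containing x, of radius k + 1. Passing to
    radius 1 adds a difference of two far kernels, bounded and zero off the ball of radius 2 (k +
    1), where both equal P(0, y); it is integrable against [f]. *)
Lemma corrected_kernel_version K alpha gamma delta m b L f :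
  0 < alpha -> 0 < delta -> delta < gamma -> m%:R * delta + alpha < n%:R ->
  size_cond alpha K -> smooth_cond alpha gamma K ->
  0 <= L -> hoelder_const delta b L -> measurable_fun setT f ->
  (forall rho, (0 < rho)%R -> \int[mu]_(y in eball 0 rho) `|f y|%:E < +oo)%E ->
  (forall rho, (0 < rho)%R -> \int[mu]_(x in eball 0 rho) \int[mu]_y
      `|corrected_kernel K b m 0 rho x y * f y|%:E < +oo)%E ->
  kernel_version K b m f (far_kernel K b m 0 1)
    (fun x => \int[mu]_y (corrected_kernel K b m 0 1 x y * f y)).
Proof.
move=> a0 d0 dg an Ks Ksm L0 Hb mf foo Qoo.
have mK := measurable_smooth_kernel (lt_trans d0 dg) Ksm.
have mb := measurable_hoelder d0 Hb.
have [C1 [C10 HC1]] := Ks.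
apply: ae_eball_foralln => k.
have k0 : 0 < k.+1%:R :> R by [].
have := ae_integrable_corrected_kernel mK mb mf (Qoo _ k0).
apply: filterS => x H xk; split; last by [].
have {}H := H (le_eball (_ : k%:R <= k.+1%:R) xk); rewrite ler_nat in H.
have {}H := H (leqnSn k).
pose h y := far_kernel K b m 0 k.+1%:R y - far_kernel K b m 0 1 y.
pose M rho := C1 * L ^+ m * (2 * rho) `^ (m%:R * delta + alpha - n%:R).
have M0 rho : 0 <= M rho by rewrite !mulr_ge0 ?exprn_ge0 ?powR_ge0// ltW.
have ih : mu.-integrable setT (fun y => (h y * f y)%:E).
  apply: (@integrable_mul_bounded_support _ _ 0 (2 * k.+1%:R) (M k.+1%:R + M 1)) => //.
  - by apply: measurable_funB; exact: measurable_far_kernel.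
  - by rewrite addr_ge0.
  - by apply: foo; rewrite mulr_gt0.
  - move=> y; rewrite indicE.
    have [yB|yB] := pselect (eball 0 (2 * k.+1%:R) y).
      rewrite mem_set//= mulr1; apply: (le_trans (ler_normB _ _)).
      by apply: lerD; apply: (far_kernel_bounded (alpha := alpha)) => //; exact: ltW.
    have yB1 : ~ eball 0 (2 * 1) y.
      by move=> y1; apply: yB; apply: le_eball y1; rewrite ler_wpM2l// ler1n.
    rewrite memNset//= mulr0 normr_le0 /h /far_kernel !indicE.
    by rewrite !mem_set//= subrr.
have := integrableD measurableT H ih; apply: eq_integrable => // y _ /=.
by rewrite -EFinD /corrected_kernel /h; congr EFin; ring.
Qed.

(** On the support of the truncation [b] is bounded, so each b^j f is controlled by a Riesz
    potential of order alpha, finite at almost every x; this feeds [commutatorE]. *)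
Lemma ae_commutator_truncated K alpha gamma delta m b L f :
  0 < alpha -> alpha < n%:R -> 0 < delta -> delta < gamma ->
  size_cond alpha K -> smooth_cond alpha gamma K ->
  0 <= L -> hoelder_const delta b L -> measurable_fun setT f ->
  (forall rho, (0 < rho)%R -> \int[mu]_(y in eball 0 rho) `|f y|%:E < +oo)%E ->
  {ae mu, forall x, forall k : nat,
    mu.-integrable setT
      (fun y => (commutator_kernel K b m x y * (f \* \1_(eball 0 k%:R)) y)%:E) /\
    commutator K b m (f \* \1_(eball 0 k%:R)) x =
      \int[mu]_y (commutator_kernel K b m x y * (f \* \1_(eball 0 k%:R)) y)}.
Proof.
move=> a0 an d0 dg Ks Ksm L0 Hb mf foo.
have n0 : (0 < n)%N by rewrite -(ltr_nat R) (lt_trans a0 an).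
have mK := measurable_smooth_kernel (lt_trans d0 dg) Ksm.
have mb := measurable_hoelder d0 Hb.
have [C1 [C10 HC1]] := Ks.
have [CR CR0 HCR] := riesz_potential_near a0 an.
have mfa : measurable_fun setT (fun y => `|f y|) by exact: measurableT_comp.
have aeN : {ae mu, forall x, forall N : nat, eball 0 N.+1%:R x ->
    (\int[mu]_(y in eball 0 (2 * N.+1%:R))
       (enorm (x - y) `^ (alpha - n%:R) * `|f y|)%:E < +oo)%E}.
  apply: ae_foralln => N; apply: ae_lty_integral.
  - exact: measurable_eball.
  - apply: (measurable_funS measurableT (@subsetT _ _)).
    exact: measurable_riesz_potential.
  - by move=> x; apply: integral_ge0 => y _; rewrite lee_fin mulr_ge0// powR_ge0.
  - apply: (le_lt_trans (HCR f 0 N.+1%:R mf _)) => //.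
    rewrite lte_mul_pinfty//; last by apply: foo; rewrite mulr_gt0.
    by rewrite lee_fin mulr_ge0 ?powR_ge0// ltW.
move: aeN; apply: filterS => x Hx k; apply: commutatorE => j jm.
(* The ball of radius N + 1 then contains x, and that of radius 2 (N + 1) contains the support of
   the truncation. *)
pose N := maxn k (Num.trunc (enorm x)).
have xN : eball 0 N.+1%:R x.
  rewrite /eball/= subr0; apply: (lt_le_trans (truncnS_gt _)).
  by rewrite ler_nat ltnS leq_maxr.
have {}Hx := Hx N xN.
pose Mb := `|b 0| + L * k%:R `^ delta.
have Mb0 : 0 <= Mb by rewrite addr_ge0// mulr_ge0// powR_ge0.
have bM y : eball 0 k%:R y -> `|b y| <= Mb.
  rewrite /eball/= => yk; rewrite -[b y](subrKC (b 0)); apply: (le_trans (ler_normD _ _)).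
  rewrite lerD2l; apply: (le_trans (Hb y 0)); rewrite ler_wpM2l//.
  by apply: ler_powRl; [exact: ltW|exact: enorm_ge0|exact: ltW].
have mF : measurable_fun setT (fun y => K (x - y) * (b y ^+ j * (f \* \1_(eball 0 k%:R)) y)).
  apply: measurable_funM; first exact: (measurableT_comp mK (measurable_subVl x)).
  apply: measurable_funM; first exact: measurable_funX.
  by apply: measurable_funM => //; apply: measurable_indic; exact: measurable_eball.
pose u y := (enorm (x - y) `^ (alpha - n%:R) * `|f y|)%:E : \bar R.
have u0 y : (0 <= u y)%E by rewrite lee_fin mulr_ge0// powR_ge0.
have mu_ : measurable_fun (eball 0 (2 * N.+1%:R)) u.
  apply: (measurable_funS measurableT (@subsetT _ _)).
  apply/measurable_EFinP; apply: measurable_funM => //.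
  apply: (measurableT_comp (measurable_powR _)).
  exact: (measurableT_comp measurable_enorm (measurable_subVl x)).
have C0 : 0 <= C1 * Mb ^+ j by rewrite mulr_ge0 ?exprn_ge0// ltW.
apply/integrableP; split; first exact/measurable_EFinP.
apply: (@le_lt_trans _ _ ((C1 * Mb ^+ j)%:E *
    \int[mu]_(y in eball 0 (2 * N.+1%:R)) u y)%E); last by rewrite lte_mul_pinfty.
rewrite -ge0_integralZl//; last exact: measurable_eball.
rewrite [leRHS]integral_mkcond; apply: ae_ge0_le_integral => //.
- by apply: measurableT_comp => //; exact/measurable_EFinP.
- by move=> y _; rewrite patchE; case: ifP => // _; rewrite mule_ge0.
- apply: (proj1 (measurable_restrictT _ (measurable_eball _ _))).
  exact: emeasurable_funM.
- have := ae_neq x n0; apply: filterS => y yx _.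
  rewrite /= indicE; have [yk|yk] := pselect (eball 0 k%:R y); last first.
    rewrite memNset// !mulr0 normr0 patchE; case: ifP => // _.
    by rewrite mule_ge0.
  have yN : eball 0 (2 * N.+1%:R) y.
    apply: le_eball yk; rewrite -natrM ler_nat.
    by rewrite (leq_trans (leq_maxl k (Num.trunc (enorm x))))// -/N mul2n -addnn ltnW// ltnS leq_addr.
  rewrite patchE !mem_set//= mulr1 -EFinM lee_fin normrM.
  rewrite normrM normrX mulrCA [C1 * _]mulrC -mulrA mulrA [leRHS]mulrA.
  have xy : x - y <> 0.
    by move=> /eqP; rewrite subr_eq0 => /eqP xy; apply: yx.
  have h1 := HC1 _ xy; have h2 := bM _ yk.
  rewrite [leLHS](_ : _ = `|b y| ^+ j * (`|K (x - y)| * `|f y|)); last by ring.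
  rewrite -[leRHS]mulrA; apply: ler_pM; rewrite ?mulr_ge0 ?exprn_ge0//.
    by apply: lerXn2r; rewrite ?nnegrE.
  by rewrite mulrA ler_wpM2r.
Qed.

(** The correcting constant is the integral of the far kernel against the truncation. What remains
    is the corrected kernel against the truncation, and dominated convergence applies with the
    absolute value of the full integrand as majorant. *)
Lemma corrected_kernel_commutator_mod_const K alpha gamma delta m b L f :
  0 < alpha -> 0 < delta -> delta < gamma -> m%:R * delta + alpha < n%:R ->
  size_cond alpha K -> smooth_cond alpha gamma K ->
  0 <= L -> hoelder_const delta b L -> measurable_fun setT f ->
  (forall rho, (0 < rho)%R -> \int[mu]_(y in eball 0 rho) `|f y|%:E < +oo)%E ->
  kernel_version K b m f (far_kernel K b m 0 1)
    (fun x => \int[mu]_y (corrected_kernel K b m 0 1 x y * f y)) ->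
  commutator_mod_const K b m f
    (fun x => \int[mu]_y (corrected_kernel K b m 0 1 x y * f y)).
Proof.
move=> a0 d0 dg an Ks Ksm L0 Hb mf foo HF.
have mK := measurable_smooth_kernel (lt_trans d0 dg) Ksm.
have mb := measurable_hoelder d0 Hb.
have [C1 [C10 HC1]] := Ks.
have an' : alpha < n%:R by apply: le_lt_trans an; rewrite lerDr mulr_ge0// ltW.
pose f_ (k : nat) := f \* \1_(eball 0 k%:R).
have mf_ k : measurable_fun setT (f_ k).
  by apply: measurable_funM => //; apply: measurable_indic; exact: measurable_eball.
have mfar := measurable_far_kernel m 0 1 mK mb.
pose M := C1 * L ^+ m * (2 * 1) `^ (m%:R * delta + alpha - n%:R).
have M0 : 0 <= M by rewrite !mulr_ge0 ?exprn_ge0 ?powR_ge0// ltW.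
have ifar k : mu.-integrable setT (fun y => (far_kernel K b m 0 1 y * f_ k y)%:E).
  (* The extra indicator is 1 on the support of [f_ k]; it gives the kernel a bounded support of
     positive radius even for k = 0. *)
  have : mu.-integrable setT
      (fun y => (far_kernel K b m 0 1 y * \1_(eball 0 k.+1%:R) y * f_ k y)%:E).
    apply: (@integrable_mul_bounded_support _ _ 0 k.+1%:R M) => //.
    - by apply: measurable_funM => //; apply: measurable_indic; exact: measurable_eball.
    - apply: le_lt_trans (foo k.+1%:R _) => //.
      apply: ge0_le_integral => //; first exact: measurable_eball.
      + apply: (measurable_funS measurableT (@subsetT _ _)).
        by apply/measurable_EFinP; exact: measurableT_comp.
      + apply: (measurable_funS measurableT (@subsetT _ _)).
        by apply/measurable_EFinP; exact: measurableT_comp.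
      + move=> y _; rewrite lee_fin /f_ /= normrM ler_piMr// indicE.
        by case: (_ \in _); rewrite ?normr1 ?normr0.
    - move=> y; rewrite normrM [`|\1__ _|]ger0_norm ?ler_wpM2r//.
      by apply: (far_kernel_bounded (alpha := alpha)) => //; exact: ltW.
  apply: eq_integrable => // y _; rewrite /f_ /= !indicE.
  have [yk|yk] := pselect (eball 0 k%:R y).
    have yk1 : eball 0 k.+1%:R y by apply: le_eball yk; rewrite ler_nat.
    by rewrite !mem_set//= !mulr1.
  by rewrite [y \in eball 0 k%:R]memNset// !mulr0.
exists (fun k => \int[mu]_y (far_kernel K b m 0 1 y * f_ k y)).
have aeT := @ae_commutator_truncated K alpha gamma delta m b L f a0 an' d0 dg Ks Ksm L0 Hb mf foo.
apply: filterS2 HF aeT => x [iF _] HT.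
pose q y := corrected_kernel K b m 0 1 x y * f y.
have iq : mu.-integrable setT (EFin \o q) by exact: iF.
have mq : measurable_fun setT q by apply/measurable_EFinP; exact: measurable_int iq.
pose q_ k y := q y * \1_(eball 0 k%:R) y.
have seqE k : commutator K b m (f_ k) x - \int[mu]_y (far_kernel K b m 0 1 y * f_ k y) =
    \int[mu]_y q_ k y.
  have [I ->] := HT k; rewrite -(RintegralB measurableT I (ifar k)).
  by apply: eq_Rintegral => y _; rewrite /q_ /q /corrected_kernel /f_ /=; ring.
rewrite (_ : (fun k => _) = fun k => \int[mu]_y q_ k y); last by apply/funext => k; exact: seqE.
have mq_ k : measurable_fun setT (q_ k).
  by apply: measurable_funM => //; apply: measurable_indic; exact: measurable_eball.
have q_q : {ae mu, forall y, setT y -> (EFin \o q_ k) y @[k --> \oo] --> (EFin \o q) y}.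
  apply: nearW => y _; apply: cvg_near_cst.
  exists (Num.trunc (enorm y)).+1 => // k /= yk.
  rewrite /q_ indicE mem_set ?mulr1// /eball/= subr0.
  by apply: (lt_le_trans (truncnS_gt _)); rewrite ler_nat.
have q_le : {ae mu, forall y, forall k, setT y ->
    (`|(EFin \o q_ k) y| <= (abse \o (EFin \o q)) y)%E}.
  apply: nearW => y k _; rewrite /= lee_fin /q_ normrM ler_piMr// indicE.
  by case: (_ \in _); rewrite ?normr1 ?normr0.
have mEq_ k : measurable_fun setT (EFin \o q_ k) by exact/measurable_EFinP.
have mEq : measurable_fun setT (EFin \o q) by exact/measurable_EFinP.
have [_ _ cvgI] := dominated_convergence measurableT mEq_ mEq q_q
  (integrable_abse iq) q_le.
have fq : (\int[mu]_y (EFin \o q) y)%E \is a fin_num by exact: integrable_fin_num iq.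
by apply: fine_cvg; rewrite fineK.
Qed.

End truncations.

(** * From ball estimates to the weighted seminorm *)

Section weighted_seminorm.
Context {R : realType} {n : nat}.
Local Notation Rn := 'rV[R]_n.
Local Notation mu := (leb R n).
Implicit Types (c x y : Rn) (rho L : R) (b f g v w K Phi : Rn -> R) (m : nat).

Lemma inv_sup_gt0 w c rho : {ae mu, forall x, 0 < w x} -> 0 < rho ->
  (0 < inv_sup w (eball c rho))%E.
Proof.
move=> w0 r0; rewrite ltNge; apply/negP.
rewrite /inv_sup unlock leb_setT_gt0 => /ess_supP/= h.
have [x xB [wx]] : exists2 x, eball c rho x & 0 < w x /\
    (`|((w x)^-1 * \1_(eball c rho) x)%:E| <= 0)%E.
  by apply: (ae_eballP r0); apply: filterS2 w0 h.
rewrite lee_fin normr_le0 indicE mem_set// mulr1 invr_eq0 => /eqP wx0.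
by move: wx; rewrite wx0 ltxx.
Qed.

Lemma H_factor_ge0 r (a delta : R) v c rho : (0 <= H_factor r a delta v c rho)%E.
Proof.
by rewrite /H_factor; case: ifP => _; [exact: Lnorm_ge0|exact: poweR_ge0].
Qed.

(** The cube inside the ball gives 2 rho/(n+1) <= |B|^(1/n), which is raised to the power n +
    delta. *)
Lemma powR_le_vol (delta : R) c rho : (0 < n)%N -> 0 < delta -> 0 < rho ->
  rho `^ (n%:R + delta) <=
  (n.+1%:R / 2) `^ (n%:R + delta) * vol (eball c rho) `^ (1 + delta / n%:R).
Proof.
move=> n0 d0 r0; have n0' : 0 < n%:R :> R by rewrite ltr0n.
have nd0 : 0 <= n%:R + delta by rewrite addr_ge0// ltW.
have e0 : 0 < 2 * (rho / n.+1%:R) by rewrite mulr_gt0// divr_gt0.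
have V0 := vol_gt0 c r0.
have -> : vol (eball c rho) `^ (1 + delta / n%:R) =
    (vol (eball c rho) `^ n%:R^-1) `^ (n%:R + delta).
  by rewrite -powRrM; congr (_ `^ _); field; rewrite gt_eqF.
rewrite -powRM ?powR_ge0 ?divr_ge0//; apply: ler_powRl => //; first exact: ltW.
have h : 2 * (rho / n.+1%:R) <= vol (eball c rho) `^ n%:R^-1.
  have -> : 2 * (rho / n.+1%:R) = ((2 * (rho / n.+1%:R)) ^+ n) `^ n%:R^-1.
    rewrite -powR_mulrn ?(ltW e0)// -powRrM divff ?gt_eqF// powRr1//.
    exact: ltW.
  apply: ler_powRl; rewrite ?invr_ge0 ?(ltW n0')//; last exact: vol_ge.
  by rewrite exprn_ge0// ltW.
rewrite [leLHS](_ : _ = n.+1%:R / 2 * (2 * (rho / n.+1%:R))); last first.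
  have : n.+1%:R != 0 :> R by [].
  by move: n.+1%:R => N N0; field.
by rewrite ler_wpM2l ?divr_ge0.
Qed.

(** An infinite [H_factor] would make the supremum infinite, because the other two factors are
    positive; this matters since 0 times infinity is 0 here. *)
Lemma H_factor_lty r (a delta deltat : R) v w c rho :
  {ae mu, forall x, 0 < w x} -> H_class r a delta deltat v w -> 0 < rho ->
  (H_factor r a delta v c rho < +oo)%E.
Proof.
move=> w0 HH r0; rewrite ltey; apply/eqP => Hoo.
move: HH; rewrite /H_class; apply/negP; rewrite -leNgt.
apply: ereal_sup_ubound => /=; exists c, rho; split => //.
rewrite Hoo gt0_muley// mule_gt0//; first exact: inv_sup_gt0.
by rewrite lte_fin powR_gt0// vol_gt0.
Qed.

Lemma integral_ball_decay_lty r (a delta deltat : R) v w f c rho :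
  (1 <= r)%E -> weight v -> weight w -> H_class r a delta deltat v w ->
  measurable_fun setT f -> (fun x => f x / v x) \in Lfun mu r -> 0 < rho ->
  (\int[mu]_y (`|f y| * ball_decay (n%:R - a + delta) c rho y)%:E < +oo)%E.
Proof.
move=> r1 [/loc_integrable_measurable mv v0] [_ w0] HH mf fv r0.
have Hoo := H_factor_lty c w0 HH r0.
apply: le_lt_trans (integral_ball_decay_le r1 mv v0 mf fv Hoo) _.
have /andP[_] := fv; rewrite inE => Noo.
rewrite -ge0_fin_numE ?mule_ge0 ?H_factor_ge0 ?Lnorm_ge0//.
by rewrite fin_numM// ge0_fin_numE ?H_factor_ge0 ?Lnorm_ge0.
Qed.

Lemma kernel_version_Lw_seminorm K alpha gamma delta deltat m (r : \bar R) v w :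
  0 < alpha -> 0 < delta -> delta < gamma -> m%:R * delta + alpha < n%:R ->
  size_cond alpha K -> smooth_cond alpha gamma K -> (1 <= r)%E ->
  weight v -> weight w ->
  H_class r (m%:R * delta + alpha) delta deltat v w ->
  exists2 C : R, 0 < C & forall b L f g Phi,
    0 <= L -> hoelder_const delta b L -> measurable_fun setT f ->
    (fun x => f x / v x) \in Lfun mu r ->
    measurable_fun setT Phi -> kernel_version K b m f g Phi ->
    loc_integrable Phi /\
    (Lw_seminorm w (deltat / n%:R) Phi <=
     (C * L ^+ m)%:E * 'N[mu]_r[EFin \o (fun x => f x / v x)%R])%E.
Proof.
move=> a0 d0 dg an Ks Ksm r1 wv ww HH.
have [/loc_integrable_measurable mv v0] := wv; have [_ w0] := ww.
have g0 : 0 < gamma by exact: lt_trans dg.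
have mK := measurable_smooth_kernel g0 Ksm.
have n0 : (0 < n)%N.
  by rewrite -(ltr_nat R) (lt_trans a0)// (le_lt_trans _ an)// lerDr mulr_ge0// ltW.
have [C0 C00 HC0] := corrected_kernel_ball_estimate a0 d0 dg an Ks Ksm.
set a := m%:R * delta + alpha in an HH HC0 *.
pose T c rho := (inv_sup w (eball c rho)
  * (vol (eball c rho) `^ ((delta - deltat) / n%:R))%:E * H_factor r a delta v c rho)%E.
move: (HH); rewrite /H_class; set S := ereal_sup _ => Soo.
have TS c rho : 0 < rho -> (T c rho <= S)%E.
  by move=> r0; apply: ereal_sup_ubound; exists c, rho.
have T0 c rho : (0 <= T c rho)%E.
  rewrite mule_ge0 ?H_factor_ge0// mule_ge0 ?lee_fin ?powR_ge0//.
  exact: Lnorm_ge0.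
have S0 : (0 <= S)%E by exact: le_trans (TS 0 1 ltr01).
have [s sE s0] : exists2 s : R, S = s%:E & 0 <= s.
  by move: Soo S0; case: (S) => // s _ s0; exists s.
pose kappa : R := (n.+1%:R / 2) `^ (n%:R + delta).
have kappa0 : 0 <= kappa by exact: powR_ge0.
have C00' := ltW C00.
(* The added 1 keeps the constant positive even if s = 0. *)
exists (2 * C0 * kappa * s + 1); first by rewrite ltr_wpDl// !mulr_ge0.
move=> b L f g Phi L0 Hb mf fv mPhi HPhi.
have mb := measurable_hoelder d0 Hb.
set N := 'N[mu]_r[_]%E.
have N0 : (0 <= N)%E by exact: Lnorm_ge0.
pose J c rho := (\int[mu]_y (`|f y| * ball_decay (n%:R - a + delta) c rho y)%:E)%E.
have JNH c rho : 0 < rho -> (J c rho <= N * H_factor r a delta v c rho)%E.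
  move=> r0; apply: integral_ball_decay_le => //.
  exact: H_factor_lty w0 HH r0.
have Joo c rho : 0 < rho -> (J c rho < +oo)%E.
  by move=> r0; exact: integral_ball_decay_lty HH mf fv r0.
have osc c rho : 0 < rho ->
    mu.-integrable (eball c rho) (EFin \o Phi) /\
    (\int[mu]_(x in eball c rho) `|Phi x - mean (eball c rho) Phi|%:E <=
     (2 * C0 * L ^+ m * rho `^ (n%:R + delta))%:E *
       (N * H_factor r a delta v c rho))%E.
  move=> r0; have H := HC0 b L f c rho L0 Hb mf r0.
  have k0 : 0 <= C0 * L ^+ m * rho `^ (n%:R + delta).
    by rewrite !mulr_ge0 ?exprn_ge0 ?powR_ge0.
  have [|h1 h2] := kernel_version_oscillation mK mb mf mPhi HPhi r0 (c := c).
    apply: le_lt_trans H _; rewrite lte_mul_pinfty ?lee_fin//.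
    exact: Joo.
  split=> //; apply: (le_trans h2).
  rewrite -!mulrA EFinM -muleA; apply: lee_wpmul2l => //.
  rewrite !mulrA; apply: (le_trans H).
  by apply: lee_wpmul2l; rewrite ?lee_fin//; exact: JNH.
split.
  by move=> c rho r0; exact: (osc c rho r0).1.
apply: ub_ereal_sup => _ [c [rho [r0 ->]]] /=.
have [_ h] := osc c rho r0.
set inv := inv_sup w _; set V := vol _; set H := H_factor _ _ _ _ _ _ in h.
have V0 : 0 < V by exact: vol_gt0.
have inv0 : (0 <= inv)%E by exact: Lnorm_ge0.
have H0 : (0 <= H)%E by exact: H_factor_ge0.
have L0' : 0 <= 2 * C0 * L ^+ m by rewrite !mulr_ge0 ?exprn_ge0.
have Vle : (V `^ (1 + deltat / n%:R))^-1 * (2 * C0 * L ^+ m * rho `^ (n%:R + delta)) <=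
    2 * C0 * L ^+ m * kappa * V `^ ((delta - deltat) / n%:R).
  rewrite mulrCA -[leRHS]mulrA ler_wpM2l//.
  have -> : (delta - deltat) / n%:R = - (1 + deltat / n%:R) + (1 + delta / n%:R) by ring.
  rewrite (powRDp (- (1 + deltat / n%:R)) _ V0) mulrCA powRN ler_wpM2l ?invr_ge0 ?powR_ge0//.
  exact: powR_le_vol.
apply: (@le_trans _ _ (inv * ((2 * C0 * L ^+ m * kappa * V `^ ((delta - deltat) / n%:R))%:E
    * (N * H)))%E).
  rewrite -muleA; apply: lee_wpmul2l => //.
  apply: (@le_trans _ _ (((V `^ (1 + deltat / n%:R))^-1)%:E *
    ((2 * C0 * L ^+ m * rho `^ (n%:R + delta))%:E * (N * H)))%E).
    by apply: lee_wpmul2l => //; rewrite lee_fin invr_ge0 powR_ge0.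
  rewrite muleA -EFinM; apply: lee_wpmul2r; first by rewrite mule_ge0.
  by rewrite lee_fin.
have -> : (inv * ((2 * C0 * L ^+ m * kappa * V `^ ((delta - deltat) / n%:R))%:E * (N * H)) =
    (2 * C0 * L ^+ m * kappa)%:E * N * T c rho)%E.
  rewrite /T -/inv -/V -/H (EFinM (2 * C0 * L ^+ m * kappa)).
  by rewrite muleACA (muleCA inv) (muleA inv).
apply: (@le_trans _ _ ((2 * C0 * L ^+ m * kappa)%:E * N * S)%E).
  apply: lee_wpmul2l; last exact: TS.
  by rewrite mule_ge0// lee_fin mulr_ge0.
rewrite sE muleAC -EFinM; apply: lee_wpmul2r => //; rewrite lee_fin.
rewrite (mulrDl (2 * C0 * kappa * s)) mul1r.
rewrite [leLHS](_ : _ = 2 * C0 * kappa * s * L ^+ m); last by ring.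
by rewrite lerDl exprn_ge0.
Qed.

End weighted_seminorm.

Theorem theorem2p6 (R : realType) (n : nat) (alpha gamma : R)
    (K : 'rV[R]_n -> R) (m : nat) (delta deltat : R) (r : \bar R)
    (v w : 'rV[R]_n -> R) (alphat := m%:R * delta + alpha)
    (alpha_gt0 : 0 < alpha) (alpha_ltn : alpha < n%:R)
    (K_neq0 : exists x : 'rV[R]_n, x <> 0 /\ K x <> 0)
    (K_size : size_cond alpha K)
    (gamma_gt0 : 0 < gamma) (gamma_le1 : gamma <= 1)
    (K_smooth : smooth_cond alpha gamma K)
    (delta_gt0 : 0 < delta)
    (* in the extended reals, x / 0 = +oo for x > 0 *)
    (delta_lt : (delta%:E < mine gamma%:E ((n%:R - alpha)%:E / m%:R%:E))%E)
    (r_ge1 : (1 <= r)%E)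
    (deltat_le : (deltat%:E <= alphat%:E - n%:R%:E / r)%E)
    (deltat_le_delta : deltat <= delta)
    (v_weight : weight v) (w_weight : weight w)
    (vw_H : H_class r alphat delta deltat v w) :
  exists C : R, 0 < C /\
    forall b f : 'rV[R]_n -> R,
      Lip delta b -> measurable_fun setT f ->
      (fun x => f x / v x) \in Lfun (leb R n) r ->
      let bound :=
        ((C * Lip_norm delta b ^+ m)%:E
         * 'N[leb R n]_r[EFin \o (fun x => f x / v x)%R])%E in
      (commutator_dom K b m f ->
        (Lw_seminorm w (deltat / n%:R) (commutator K b m f) <= bound)%E)
      /\
      (exists F : 'rV[R]_n -> R,
        [/\ loc_integrable F, commutator_mod_const K b m f F
          & (Lw_seminorm w (deltat / n%:R) F <= bound)%E]).

Proof.
have [dg dm] : delta < gamma /\ alphat < n%:R.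
  move: delta_lt; rewrite lt_min !lte_fin => /andP[dg dnm]; split => //.
  (* For m = 0 the quotient is infinite and bounds nothing, but then alphat = alpha < n. *)
  rewrite /alphat; have [m0|m0] := posnP m; first by rewrite m0 mul0r add0r.
  move: dnm; rewrite inver pnatr_eq0 gtn_eqF// -EFinM lte_fin.
  by rewrite ltr_pdivlMr ?ltr0n// mulrC; lra.
have n0 : (0 < n)%N by rewrite -(ltr_nat R) (lt_trans alpha_gt0).
have mK := measurable_smooth_kernel gamma_gt0 K_smooth.
have [C C0 HC] := kernel_version_Lw_seminorm alpha_gt0 delta_gt0 dg dm K_size
  K_smooth r_ge1 v_weight w_weight vw_H.
exists C; split=> // b f Lb mf fv bound.
have L0 := Lip_norm_ge0 n0 Lb; have Hb := hoelder_Lip_norm Lb.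
have mb := measurable_hoelder delta_gt0 Hb.
split.
  move=> fdom; have [_] := HC b _ f (cst 0) (commutator K b m f) L0 Hb mf fv
    (measurable_commutator m mK mb mf) (kernel_version_commutator fdom).
  exact.
(* Without a domain hypothesis, the finiteness of J supplies the local integrability of [f] and the
   a.e. convergence of the corrected integrals. *)
have [C1 C10 HC1] := corrected_kernel_ball_estimate alpha_gt0 delta_gt0 dg dm K_size K_smooth.
have Joo c rho : 0 < rho -> (\int[leb R n]_y
    (`|f y| * ball_decay (n%:R - alphat + delta) c rho y)%:E < +oo)%E.
  by move=> r0; exact: integral_ball_decay_lty vw_H mf fv r0.
have foo rho : 0 < rho -> (\int[leb R n]_(y in eball 0 rho) `|f y|%:E < +oo)%E.
  (* Half the radius, since the near estimate integrates over the doubled ball. *)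
  move=> r0; have r20 : 0 < rho / 2 by rewrite divr_gt0.
  have E0 : 0 <= n%:R - alphat + delta by rewrite addr_ge0 ?subr_ge0 ?(ltW dm)// ltW.
  have := integral_near_le_decay 0 n0 E0 r20 mf.
  rewrite mulrC divfK// => h; apply: (le_lt_trans h).
  by rewrite lte_mul_pinfty ?lee_fin ?powR_ge0// Joo.
have Qoo rho : 0 < rho -> (\int[leb R n]_(x in eball 0 rho) \int[leb R n]_y
    `|corrected_kernel K b m 0 rho x y * f y|%:E < +oo)%E.
  move=> r0; apply: (le_lt_trans (HC1 b _ f 0 rho L0 Hb mf r0)).
  by rewrite lte_mul_pinfty ?Joo// lee_fin !mulr_ge0 ?exprn_ge0 ?powR_ge0// ltW.
have HF := corrected_kernel_version alpha_gt0 delta_gt0 dg dm K_size K_smooth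
  L0 Hb mf foo Qoo.
set F := (X in kernel_version _ _ _ _ _ X) in HF.
have mF : measurable_fun setT F.
  apply: (measurable_leb_Rintegral
    (f := fun p => corrected_kernel K b m 0 1 p.1 p.2 * f p.2)).
  apply: measurable_funM; first exact: measurable_corrected_kernel2.
  exact: (measurableT_comp mf measurable_snd).
have [locF leF] := HC b _ f _ F L0 Hb mf fv mF HF.
exists F; split => //.
exact: (corrected_kernel_commutator_mod_const alpha_gt0 delta_gt0 dg dm K_size
  K_smooth L0 Hb mf foo HF).
Qed.
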